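(* Let $c>0$, $c_0>0$, $n\ge 1$, $A\in\mathbb{R}^{n\times n}$, $B\in\mathbb{R}^{n\times 1}$, $K\in\mathbb{R}^{1\times n}$, and consider the coupled ODE/string system $$\dot X(t)=AX(t)+B\,(u(1,t)+r(t)),\quad u_{tt}(x,t)=c^2u_{xx}(x,t),\quad u(0,t)=KX(t),\quad u_x(1,t)=-c_0u_t(1,t),$$ for $x\in[0,1]$, $t\ge 0$, with input $r$ and output $Y=KX$. Let $\mathcal{H}(s)=K(sI-A)^{-1}B$ and $\|\mathcal{H}\|_\infty=\max_{w\in[0,+\infty)}|\mathcal{H}(iw)|$. Assume that $A$ is Hurwitz and that $\|\mathcal{H}\|_\infty<1$. If $$\|\mathcal{H}\|_\infty< c\,c_0,$$ then the coupled system is input/output stable.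
   Context: In the coupled system, $X(t)\in\mathbb{R}^n$ is the ODE state, $u(x,t)\in\mathbb{R}$ the string displacement, $c$ the wave speed and $c_0$ the boundary damping coefficient. The initial data $X(0)=X_0\in\mathbb{R}^n$, $u(\cdot,0)=u_0\in H^2(0,1)$, $u_t(\cdot,0)=v_0\in H^1(0,1)$ are compatible with the boundary conditions ($u_0(0)=KX_0$, $u_0'(1)=-c_0v_0(1)$); the input/output analysis is done in the Laplace domain with zero initial conditions. Input/output stable: for every input $r$ of bounded energy (i.e. $r\in L^2(0,\infty)$), the output $Y=KX$ also has bounded energy (i.e. $Y\in L^2(0,\infty)$). With zero initial conditions, the Laplace transforms satisfy $U(1,s)=\mathcal{W}(s)U(0,s)$ with $\mathcal{W}(s)=\frac{(1+\alpha)e^{-s/c}}{1+\alpha e^{-2s/c}}$, $\alpha=\frac{1-cc_0}{1+cc_0}$, and the transfer function from $r$ to $Y$ is $\mathcal{F}=\mathcal{H}/(1-\mathcal{H}\mathcal{W})$. A square matrix is Hurwitz if all its eigenvalues have strictly negative real part. *)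

(* Defs.v *)
From mathcomp Require Import all_boot all_order all_algebra.
From mathcomp Require Import all_classical all_reals all_analysis.
From mathcomp Require Import complex.

Set Implicit Arguments.
Unset Strict Implicit.
Unset Printing Implicit Defensive.

Import Order.TTheory GRing.Theory Num.Theory.
Import numFieldNormedType.Exports.

Local Open Scope classical_set_scope.
Local Open Scope ring_scope.

Definition mx_complex (R : realType) (m n : nat) (M : 'M[R]_(m, n)) :
  'M[R[i]]_(m, n) := map_mx (real_complex R) M.

Definition hurwitz (R : realType) (n : nat) (A : 'M[R]_n) : Prop :=
  forall z : R[i], eigenvalue (mx_complex A) z -> complex.Re z < 0.

Definition transfer (R : realType) (n : nat) (A : 'M[R]_n) (B : 'cV[R]_n)
    (K : 'rV[R]_n) (s : R[i]) : R[i] :=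
  (mx_complex K *m invmx (s%:M - mx_complex A) *m mx_complex B) 0 0.

(* For Hurwitz A, w |-> |H(iw)| is continuous on [0, +oo[ and vanishes at
   infinity, so that this supremum is a maximum. *)
Definition transfer_norm (R : realType) (n : nat) (A : 'M[R]_n) (B : 'cV[R]_n)
    (K : 'rV[R]_n) : R :=
  sup [set ComplexField.Normc.normc (transfer A B K (Complex 0 w))
      | w in `[0, +oo[].

(* Square-integrable on (0, +oo). *)
Definition bounded_energy (R : realType) (f : R -> R) : Prop :=
  measurable_fun (`[0, +oo[ : set R) f /\
  (\int[@lebesgue_measure R]_(t in `[0%R, +oo[) ((f t) ^+ 2)%:E < +oo)%E.

(* Functions of (x, t) are curried, the space variable x coming first. *)
Definition dx (R : realType) (f : R -> R -> R) : R -> R -> R :=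
  fun x t => derive1 (f^~ t) x.

Definition dt (R : realType) (f : R -> R -> R) : R -> R -> R :=
  fun x t => derive1 (f x) t.

Definition C0_2d (R : realType) (f : R -> R -> R) : Prop :=
  continuous (fun p : R * R => f p.1 p.2).

Definition C1_2d (R : realType) (f : R -> R -> R) : Prop :=
  [/\ C0_2d f,
      forall x t : R, derivable (f^~ t) x 1,
      forall x t : R, derivable (f x) t 1,
      C0_2d (dx f) & C0_2d (dt f)].

Definition C2_2d (R : realType) (f : R -> R -> R) : Prop :=
  [/\ C1_2d f, C1_2d (dx f) & C1_2d (dt f)].

(* Restricted to [0, 1] x [0, +oo[, these vanish at x = 0 and for large t;
   nothing is imposed at t = 0 or at x = 1. *)
Definition test_function (R : realType) (phi : R -> R -> R) : Prop :=
  [/\ C2_2d phi,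
      forall t : R, 0 <= t -> phi 0 t = 0 &
      exists T : R, forall x t : R, 0 <= x <= 1 -> T <= t -> phi x t = 0].

(* Weak form of
     u_tt = c^2 u_xx on ]0, 1[ x ]0, +oo[,  u_x(1, t) = - c0 u_t(1, t),
     u(., 0) = u0,  u_t(., 0) = v0.
   Multiply the equation by phi, integrate over [0, 1] x [0, +oo[, and
   integrate by parts twice in x and twice in t, so that all the derivatives
   fall on phi.  The boundary terms are
   - at x = 1:  - c^2 (u_x phi - u phi_x) = c^2 (c0 u_t phi + u phi_x), where
     one more integration by parts in t turns c0 u_t phi into - c0 u phi_t and
     gives the corner term - c0 u0(1) phi(1, 0);
   - at x = 0:  - c^2 u phi_x, since phi(0, .) = 0;
   - at t = 0:  u0 phi_t - v0 phi.
   The pointwise equations cannot be required: for an input r that is merely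
   square-integrable, X and hence u(0, .) are only once weakly
   differentiable. *)
Definition weak_damped_string (R : realType) (c c0 : R) (u0 v0 : R -> R)
    (u : R -> R -> R) : Prop :=
  let mu := @lebesgue_measure R in
  forall phi : R -> R -> R, test_function phi ->
    \int[mu]_(t in `[0, +oo[) \int[mu]_(x in `[0, 1])
        (u x t * (dt (dt phi) x t - c ^+ 2 * dx (dx phi) x t))
    + c ^+ 2 * \int[mu]_(t in `[0, +oo[)
        (u 1 t * (dx phi 1 t - c0 * dt phi 1 t))
    - c ^+ 2 * \int[mu]_(t in `[0, +oo[) (u 0 t * dx phi 0 t)
    + \int[mu]_(x in `[0, 1]) (u0 x * dt phi x 0 - v0 x * phi x 0)
    - c ^+ 2 * c0 * (u0 1 * phi 1 0) = 0.

(* The differential equation on X is understood in the sense of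
   Caratheodory, i.e. in integrated form. *)
Record coupled_solution (R : realType) (n : nat) (c c0 : R) (A : 'M[R]_n)
    (B : 'cV[R]_n) (K : 'rV[R]_n) (X0 : 'cV[R]_n) (u0 v0 : R -> R)
    (r : R -> R) (X : R -> 'cV[R]_n) (u : R -> R -> R) : Prop := {
  ode_continuous :
    forall i, {within `[0, +oo[, continuous (fun t : R => X t i 0)};
  ode_equation : forall t : R, 0 <= t -> forall i,
    X t i 0 = X0 i 0 + \int[@lebesgue_measure R]_(s in `[0, t])
                         (A *m X s + (u 1 s + r s) *: B) i 0;
  string_continuous :
    {within `[0, 1] `*` `[0, +oo[, continuous (fun p : R * R => u p.1 p.2)};
  string_initial : forall x : R, 0 <= x <= 1 -> u x 0 = u0 x;
  string_left : forall t : R, 0 <= t -> u 0 t = (K *m X t) 0 0;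
  string_equation : weak_damped_string c c0 u0 v0 u
}.

Definition io_stable (R : realType) (n : nat) (c c0 : R) (A : 'M[R]_n)
    (B : 'cV[R]_n) (K : 'rV[R]_n) : Prop :=
  forall r : R -> R, bounded_energy r ->
  forall (X : R -> 'cV[R]_n) (u : R -> R -> R),
    coupled_solution c c0 A B K 0 (fun=> 0) (fun=> 0) r X u ->
    bounded_energy (fun t => (K *m X t) 0 0).

(* Main.v *)
(* A small-gain argument carried out in the time domain.

   Testing the weak wave equation against [g (t + x / c) - g (t - x / c)], which
   solves it and vanishes at [x = 0], eliminates the string and leaves the delay
   equation [w (t + 1/c) + alpha w (t - 1/c) = (1 + alpha) y t] between the
   traces [w = u(1, .)] and [y = u(0, .)], whose L2 gain is at most
   [max 1 (1 / (c c0))].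

   For the ODE, let [g > ||H||_oo].  The trajectories stay in the Krylov space of
   [B], where the system has controller form and [H = b / a].  The polynomial
   [g^2 a(s) a(-s) - b(s) b(-s) - e sum_l s^l (-s)^l] is positive on the imaginary
   axis for small [e], hence equal to [d(s) conj (d (- conj s))] for some [d].
   Therefore [g^2 (a(D) xi)^2 - (b(D) xi)^2 - |d(D) xi|^2 - e sum_l (xi^(l))^2]
   is the derivative of a quadratic form in the state, positive definite since
   [A] is Hurwitz, and integrating it yields
   [\int_0^T y^2 <= g^2 \int_0^T (w + r)^2] for all [T]. *)

(* A Laplace or Plancherel argument would presuppose that [y] is square-integrable, which is the
   claim. On [[0, T]] the energy of the continuous [y] is finite, so the loop inequality can be
   solved for it, with a bound independent of [T]. The gain [max 1 (1 / (c c0))] is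
   [(1 + alpha) / (1 - |alpha|)] in the two cases for the sign of [alpha]; it turns both hypotheses
   on [||H||_oo] into a loop gain below 1, with room for some [g] strictly above [||H||_oo].
   Controller form makes the state the jet of one scalar function [xi], so quadratic forms in the
   state become polynomials on the imaginary axis and the storage function comes from algebra alone.
   The factor [d] may be complex, because [|d(D) xi|^2] is a sum of two real squares anyway. The
   slack [e] makes the Lyapunov inequality strict, hence the storage form definite. The input is
   merely square-integrable, so [X] is only absolutely continuous: the product rule for the storage
   function and the uniqueness argument are carried out on integrals. *)
Require Import Defs.
From mathcomp Require Import all_boot all_order all_algebra.
From mathcomp Require Import all_classical all_reals all_analysis.
From mathcomp Require Import measurable_realfun complex ring lra zify.

Set Implicit Arguments.
Unset Strict Implicit.
Unset Printing Implicit Defensive.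

Import Order.TTheory GRing.Theory Num.Theory.
Import numFieldNormedType.Exports.

Local Open Scope classical_set_scope.
Local Open Scope ring_scope.

(** * Spectral factorization *)

(* The paraconjugate [s |-> conj (p (- conj s))]; on the imaginary axis it is
   the complex conjugate of [p]. *)
Definition paraconj (R : rcfType) (p : {poly R[i]}) : {poly R[i]} :=
  map_poly conjc p \Po (- 'X).

Lemma paraconjM (R : rcfType) (p q : {poly R[i]}) :
  paraconj (p * q) = paraconj p * paraconj q.
Proof. by rewrite /paraconj rmorphM rmorphM. Qed.

Lemma horner_paraconj (R : rcfType) (p : {poly R[i]}) (s : R[i]) :
  (paraconj p).[s] = conjc p.[conjc (- s)].
Proof.
by rewrite /paraconj horner_comp !hornerE -[X in _.[X]]conjcK horner_map.
Qed.

Lemma coef_paraconj (R : rcfType) (p : {poly R[i]}) (m : nat) :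
  (paraconj p)`_m = (-1) ^+ m * conjc p`_m.
Proof.
rewrite /paraconj coef_comp_poly.
under eq_bigr => i _.
  rewrite -mulN1r exprMn_comm; last exact: commr_polyX.
  rewrite -(rmorphN1 polyC) -(rmorphXn polyC) coefCM coefXn coef_map mulrCA.
  over.
have [mp|mp] := ltnP m (size (map_poly conjc p)).
  rewrite (bigD1 (Ordinal mp)) //= eqxx mulr1 big1 ?addr0 // => i im.
  by rewrite eq_sym (negbTE (im : i != m :> nat)) !mulr0.
rewrite big1 => [|i _]; last first.
  by rewrite gtn_eqF ?mulr0 // (leq_trans _ mp).
by rewrite nth_default ?conjc0 ?mulr0 //; rewrite size_map_poly in mp.
Qed.

Lemma imag_axis_eq0 (R : rcfType) (p : {poly R[i]}) :
  (forall w : R, p.[Complex 0 w] = 0) -> p = 0.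
Proof.
move=> p0; pose rs := [seq Complex 0 (j%:R : R) | j <- iota 0 (size p)].
apply: (@roots_geq_poly_eq0 _ p rs); last by rewrite size_map size_iota.
  by apply/allP => _ /mapP[j _ ->]; exact/eqP/p0.
rewrite map_inj_uniq ?iota_uniq// => j1 j2 [/eqP].
by rewrite eqr_nat => /eqP.
Qed.

Lemma paraconj_imag (R : rcfType) (p : {poly R[i]}) (w : R) :
  (paraconj p).[Complex 0 w] = conjc p.[Complex 0 w].
Proof.
by rewrite horner_paraconj; congr (conjc _.[_]); rewrite /= oppr0 opprK.
Qed.

(* The roots of [p] off the imaginary axis come in pairs [z], [- conj z]. *)
Lemma spectral_factorization (R : rcfType) (p : {poly R[i]}) :
  (forall w : R, 0 < p.[Complex 0 w]) -> exists d, p = d * paraconj d.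
Proof.
have [m] := ubnP (size p); elim: m p => // m IHm p; rewrite ltnS => sz_p p_gt0.
have [/size_poly1P[c _ pc]|/closed_rootP[z pz]] := boolP (size p == 1).
  have := p_gt0 0; rewrite pc hornerC => c_gt0; exists (sqrtC c)%:P.
  rewrite /paraconj map_polyC comp_polyC -polyCM.
  have /CrealP : sqrtC c \is Num.real by rewrite ger0_real// sqrtC_ge0 ltW.
  rewrite /= -[conjc _]/(Num.conj _) => ->.
  by rewrite -expr2 sqrtCK.
(* Positive values are real, so [p] and its paraconjugate agree on the axis, hence everywhere; this
   is what pairs the roots. *)
have ppE : paraconj p = p.
  apply/eqP; rewrite -subr_eq0; apply/eqP/imag_axis_eq0 => w.
  rewrite hornerD hornerN paraconj_imag -[conjc _]/(Num.conj _).
  by have /gtr0_real/CrealP -> := p_gt0 w; rewrite subrr.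
have z'z : - conjc z != z.
  apply/eqP => zz; have := p_gt0 (complex.Im z).
  case: z zz pz => a b /= [] /eqP; rewrite eq_sym -subr_eq0 opprK => aa _.
  have -> : a = 0 by lra.
  by rewrite /root => /eqP ->; rewrite ltxx.
have [p1 pE0] := factor_theorem _ _ pz.
have : root p1 (- conjc z).
  have : root p (- conjc z).
    rewrite -ppE /root horner_paraconj opprK conjcK.
    by move: pz; rewrite /root => /eqP->; rewrite conjc0.
  by rewrite pE0 rootM root_XsubC (negbTE z'z) orbF.
case/factor_theorem => p2 p1E.
have XzE : paraconj ('X - z%:P) = - ('X - (- conjc z)%:P).
  rewrite /paraconj rmorphB /= map_polyX map_polyC /= comp_polyB comp_polyX.
  by rewrite comp_polyC polyCN opprB addrC.
have pE : p = ('X - z%:P) * paraconj ('X - z%:P) * (- p2).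
  by rewrite pE0 p1E XzE; ring.
(* On the axis the extracted pair is a squared modulus, so positivity passes to the cofactor [- p2];
   the sign comes from [paraconj ('X - z) = - ('X + conj z)]. *)
have pw w : p.[Complex 0 w] =
    `|Complex 0 w - z| ^+ 2 * (- p2).[Complex 0 w].
  by rewrite {1}pE !hornerM paraconj_imag !hornerE normCK.
have p2_gt0 w : 0 < (- p2).[Complex 0 w].
  have := p_gt0 w; rewrite pw.
  have [->|nz] := eqVneq (Complex 0 w - z) 0; first by rewrite normr0 expr0n mul0r ltxx.
  by rewrite pmulr_rgt0// exprn_gt0// normr_gt0.
have p20 : - p2 != 0.
  by apply/eqP => p20; have := p2_gt0 0; rewrite p20 horner0 ltxx.
have [|d dE] := IHm (- p2) _ p2_gt0.
  have p2n0 : p2 != 0 by rewrite -oppr_eq0.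
  rewrite size_polyN (leq_trans _ sz_p)// pE0 p1E.
  rewrite !size_Mmonic ?mulf_neq0 ?polyXsubC_eq0 ?monicXsubC// !size_XsubC.
  by rewrite !addn2.
by exists (('X - z%:P) * d); rewrite pE dE paraconjM; ring.
Qed.

(* If [th] is antisymmetric-sum free along antidiagonals, solving
   [th i j = Psi (i - 1) j + Psi i (j - 1)] along them terminates, and exhibits
   the quadratic form [th] in the jet [x, x', x'', ...] as a total derivative. *)
Lemma total_derivative (F : comPzRingType) (k : nat) (th : nat -> nat -> F) :
  (forall i j, ((k < i) || (k < j))%N -> th i j = 0) ->
  (forall m, \sum_(l < m.+1) (-1) ^+ l * th l (m - l)%N = 0) ->
  exists Psi : 'M[F]_k, forall x : nat -> F,
    \sum_(i < k.+1) \sum_(j < k.+1) th i j * (x i * x j) =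
    \sum_(i < k) \sum_(j < k) Psi i j * (x i.+1 * x j + x i * x j.+1).
Proof.
move=> th0 alt.
pose Psi i j := (-1) ^+ i * \sum_(l < i.+1) (-1) ^+ l * th l (i + j.+1 - l)%N.
have Psi0 j : Psi 0 j = th 0 j.+1.
  by rewrite /Psi big_ord1 expr0 !mul1r.
have PsiS i j : Psi i.+1 j = th i.+1 j.+1 - Psi i j.+1.
  rewrite /Psi big_ord_recr /= mulrDr mulrA -expr2 sqrr_sign mul1r addrC.
  congr (th _ _ + _); first by lia.
  rewrite exprS mulN1r mulNr; congr (- (_ * _)); apply: eq_bigr => l _.
  by congr (_ * th _ _); lia.
have Psir i j : (k <= j)%N -> Psi i j = 0.
  move=> kj; rewrite /Psi big1 ?mulr0// => l _; rewrite th0 ?mulr0//.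
  by have := ltn_ord l; lia.
(* [Psi i j] is, up to sign, a partial alternating sum along an antidiagonal. Past row [k] the
   missing terms are zero, so it is the full sum, which [alt] kills: this is where the recursion
   closes. *)
have Psil i j : (k <= i)%N -> Psi i j = 0.
  move=> ki; have := alt (i + j.+1)%N.
  rewrite -addSn big_split_ord /= [X in _ + X]big1 ?addr0 => [|l _]; last first.
    by rewrite th0 ?mulr0//; apply/orP; left; rewrite /=; lia.
  by move=> S0; rewrite /Psi S0 mulr0.
have th00 : th 0 0 = 0.
  by have := alt 0; rewrite big_ord1 expr0 mul1r.
have thS0 i : th i.+1 0 = Psi i 0.
  have := alt i.+1; rewrite big_ord_recr /= subnn => /eqP.
  rewrite addr_eq0 => /eqP S0; rewrite /Psi addn1 S0 exprS mulN1r mulNr opprK.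
  by rewrite mulrA -expr2 sqrr_sign mul1r.
have thE i j : th i j = (if i is i'.+1 then Psi i' j else 0) +
                       (if j is j'.+1 then Psi i j' else 0).
  case: i j => [|i] [|j]; first by rewrite addr0.
  - by rewrite add0r Psi0.
  - by rewrite addr0 thS0.
  - by rewrite PsiS; ring.
exists (\matrix_(i, j) Psi i j) => x.
under eq_bigr => i _ do under eq_bigr => j _ do rewrite thE mulrDl.
under [RHS]eq_bigr => i _ do under eq_bigr => j _ do rewrite mxE mulrDr.
under eq_bigr => i _ do rewrite big_split /=.
under [RHS]eq_bigr => i _ do rewrite big_split /=.
rewrite !big_split /=; congr (_ + _).
  rewrite big_ord_recl /= big1 ?add0r => [|j _]; last by rewrite mul0r.
  by apply: eq_bigr => i _; rewrite big_ord_recr /= Psir// mul0r addr0.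
rewrite big_ord_recr /= [X in _ + X]big1 ?addr0 => [|j _]; last first.
  by case: j => -[|j] ? /=; rewrite ?Psil// mul0r.
by apply: eq_bigr => i _; rewrite big_ord_recl /= mul0r add0r.
Qed.

(* The matrix of the quadratic form [|q(D) xi|^2] in the jet of a real [xi]. *)
Definition gram (R : rcfType) (q : {poly R[i]}) (i j : nat) : R :=
  complex.Re q`_i * complex.Re q`_j + complex.Im q`_i * complex.Im q`_j.

Lemma gram_form (R : rcfType) (q : {poly R[i]}) (k : nat) (x : nat -> R) :
  \sum_(i < k) \sum_(j < k) gram q i j * (x i * x j) =
  (\sum_(i < k) complex.Re q`_i * x i) ^+ 2 +
  (\sum_(i < k) complex.Im q`_i * x i) ^+ 2.
Proof.
rewrite !expr2 !big_distrlr /= -big_split; apply: eq_bigr => i _ /=.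
by rewrite -big_split; apply: eq_bigr => j _; rewrite /gram /=; ring.
Qed.

Lemma gram0 (R : rcfType) (q : {poly R[i]}) (k i j : nat) :
  (size q <= k)%N -> ((k <= i) || (k <= j))%N -> gram q i j = 0.
Proof.
move=> qk /orP[ki|kj]; rewrite /gram.
  by rewrite [q`_i]nth_default ?(leq_trans qk)//= !mul0r addr0.
by rewrite [q`_j]nth_default ?(leq_trans qk)//= !mulr0 addr0.
Qed.

(** The sign in [paraconj] is the alternating one, and [gram q l (m - l)] is the real part of
    [conj q_l * q_(m-l)]. A polynomial identity thus becomes the antidiagonal condition of
    [total_derivative]. *)
Lemma gram_alternating (R : rcfType) (q : {poly R[i]}) (m : nat) :
  \sum_(l < m.+1) (-1) ^+ l * gram q l (m - l) =
  complex.Re (q * paraconj q)`_m.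
Proof.
rewrite mulrC coefM (raddf_sum (@complex.Re R : {additive R[i] -> R})).
apply: eq_bigr => l _; rewrite coef_paraconj /gram -!(signr_odd _ l) -mulrA.
rewrite !mulr_sign; case: (q`_l) (q`_(m - l)) => a b [c d].
by case: odd => /=; ring.
Qed.

(** * Inertia *)

Local Open Scope sesquilinear_scope.

Lemma adjmxM (C : numClosedFieldType) m n p (A : 'M[C]_(m, n))
    (B : 'M[C]_(n, p)) : (A *m B)^t* = B^t* *m A^t*.
Proof. by rewrite trmx_mul map_mxM. Qed.

Lemma adjmxD (C : numClosedFieldType) m n (A B : 'M[C]_(m, n)) :
  (A + B)^t* = A^t* + B^t*.
Proof. by rewrite linearD map_mxD. Qed.

(* With [e] the first basis vector, an eigenvector of [A], the Schur complement
   of [Q e e] satisfies the same hypotheses with respect to the lower right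
   block of [A]. *)
Lemma inertia_trig (C : numClosedFieldType) (n : nat) (A : 'M[C]_n) :
  is_trig_mx A -> (forall i, A i i + (A i i)^* < 0) ->
  forall Q : 'M[C]_n, Q^t* = Q ->
  (forall x : 'rV_n, x != 0 -> (x *m A *m (x *m Q)^t*) 0 0 +
     ((x *m A *m (x *m Q)^t*) 0 0)^* < 0) ->
  forall x : 'rV_n, x != 0 -> 0 < (x *m Q *m x^t*) 0 0.
Proof.
move=> At; elim/trigsqmx_ind: A / At => [|{}n a c A _ IHA] A0 Q Qh AQ x x0.
  by rewrite thinmx0 eqxx in x0.
rewrite -(submxK Q) in Qh AQ *.
move: (ulsubmx Q) (ursubmx Q) (dlsubmx Q) (drsubmx Q) Qh AQ => q p p' Q'.
rewrite tr_block_mx map_block_mx => /eq_block_mx[qh _ <- Q'h] AQ {p' Q}.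
have aa : a 0 0 + (a 0 0)^* < 0.
  by have := A0 (lshift n 0); rewrite block_mxEul.
have qC : (q 0 0)^* = q 0 0 by rewrite -[in RHS]qh !mxE.
(* On the first basis vector the hypothesis reads [(a + conj a) q < 0]. *)
have q_gt0 : 0 < q 0 0.
  have /AQ : row_mx 1%:M 0 != 0 :> 'rV[C]_(1 + n).
    apply/eqP => /(congr1 lsubmx); rewrite row_mxKl linear0 => /matrixP/(_ 0 0).
    by rewrite !mxE; apply/eqP; rewrite oner_eq0.
  rewrite !mul_row_block !mul0mx !addr0 !mul1mx.
  rewrite tr_row_mx map_col_mx mul_row_col mul0mx addr0.
  by rewrite qh mxE big_ord1 rmorphM /= qC -mulrDl nmulr_rlt0.
have qV : q *m (q 0 0)^-1%:M = 1%:M.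
  by rewrite [q]mx11_scalar -scalar_mxM !mxE mulfV// gt_eqF.
have qVq : (q 0 0)^-1%:M *m q = 1%:M.
  by rewrite [X in _ *m X]mx11_scalar -scalar_mxM mulVf// gt_eqF.
pose S := Q' - p^t* *m (q 0 0)^-1%:M *m p.
have Sh : S^t* = S.
  rewrite /S linearB /= map_mxB Q'h !adjmxM trmxCK tr_scalar_mx map_scalar_mx.
  by rewrite fmorphV /= qC mulmxA.
(* The first coordinate that makes [row_mx (ex y) y] orthogonal, for the form [Q], to the first
   basis vector: there [Q] acts as the Schur complement [S]. *)
pose ex (y : 'rV[C]_n) : 'rV[C]_1 := - (y *m p^t* *m (q 0 0)^-1%:M).
have exQ y : row_mx (ex y) y *m block_mx q p (p^t*) Q' = row_mx 0 (y *m S).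
  rewrite mul_row_block /ex !mulNmx -!mulmxA qVq mulmx1 addNr.
  by rewrite /S mulmxBr !mulmxA addrC.
clearbody S.
have S_gt0 (y : 'rV_n) : y != 0 -> 0 < (y *m S *m y^t*) 0 0.
  apply: (IHA _ S Sh) => [i|{}y y0].
    by have := A0 (rshift 1 i); rewrite block_mxEdr.
  have /AQ : row_mx (ex y) y != 0.
    by apply: contraNneq y0 => /(congr1 rsubmx); rewrite row_mxKr linear0 => ->.
  rewrite exQ mul_row_block mulmx0 add0r tr_row_mx map_col_mx mul_row_col.
  by rewrite trmx0 map_mx0 mulmx0 add0r.
rewrite -(hsubmxK x) in x0 *; move: (lsubmx x) (rsubmx x) x0 => {x} x1 y x0.
have [z zE] : exists z, z = x1 - ex y by exists (x1 - ex y).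
(* [Q]-orthogonal splitting: both cross terms vanish ([H1], [H2]), leaving [q |z|^2] plus the value
   of the form [S] at [y]. *)
have -> : row_mx x1 y = row_mx z 0 + row_mx (ex y) y.
  by rewrite add_row_mx add0r zE subrK.
rewrite mulmxDl exQ adjmxD mulmxDl !mulmxDr.
have H1 : row_mx 0 (y *m S) *m (row_mx z 0)^t* = 0.
  by rewrite tr_row_mx map_col_mx mul_row_col mul0mx trmx0 map_mx0 mulmx0 addr0.
have H2 : row_mx z 0 *m block_mx q p (p^t*) Q' *m (row_mx (ex y) y)^t* = 0.
  set M := LHS; rewrite -[M]trmxCK; suff -> : M^t* = 0.
    by rewrite trmx0 map_mx0.
  rewrite /M !adjmxM trmxCK tr_block_mx.
  by rewrite map_block_mx trmxCK qh Q'h mulmxA exQ H1.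
rewrite H1 H2 add0r addr0 mul_row_block !mul0mx !addr0.
rewrite !tr_row_mx !map_col_mx !mul_row_col mul0mx add0r trmx0 map_mx0 mulmx0 addr0.
rewrite [in X in 0 < X]mxE.
have -> : (z *m q *m z^t*) 0 0 = q 0 0 * `|z 0 0| ^+ 2.
  by rewrite normCK !mxE big_ord1 !mxE big_ord1 mulrA [in RHS]mulrAC; ring.  
have [y0|y0] := eqVneq y 0.
  rewrite y0 !mul0mx mxE addr0 mulr_gt0// exprn_gt0// normr_gt0.
  apply: contraNneq x0 => z0; rewrite y0.
  have : z = 0 by rewrite [z]mx11_scalar z0 raddf0.
  rewrite zE /ex y0 !mul0mx oppr0 subr0 => ->.
  by rewrite row_mx0.
apply: ltr_wpDl; last exact: S_gt0.
by apply: mulr_ge0; [exact: ltW|exact/exprn_ge0/normr_ge0].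
Qed.

(** Lyapunov's theorem, obtained without the matrix exponential: Schur's unitary change of basis
    makes [A] triangular and preserves the Hermitian symmetry and the strict inequality. *)
Lemma inertia (C : numClosedFieldType) (n : nat) (A Q : 'M[C]_n) :
  (forall z, eigenvalue A z -> z + z^* < 0) -> Q^t* = Q ->
  (forall x : 'rV_n, x != 0 -> (x *m A *m (x *m Q)^t*) 0 0 +
     ((x *m A *m (x *m Q)^t*) 0 0)^* < 0) ->
  forall x : 'rV_n, x != 0 -> 0 < (x *m Q *m x^t*) 0 0.
Proof.
case: n A Q => [|n] A Q A0 Qh AQ x x0; first by rewrite thinmx0 eqxx in x0.
have [P Pu] := @Schur C n.+1 A isT; rewrite /similar_to /= conjymx// => At.
have P1 : P *m P^t* = 1%:M by apply/unitarymxP.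
have P2 : P^t* *m P = 1%:M by apply: mulmx1C.
have P0 (y : 'rV_n.+1) : y != 0 -> y *m P != 0.
  apply: contraNneq => yP; rewrite -[y]mulmx1 -P1 mulmxA yP mul0mx//.
have -> : x *m Q *m x^t* = (x *m P^t*) *m (P *m Q *m P^t*) *m (x *m P^t*)^t*.
  by rewrite adjmxM trmxCK !mulmxA -[x *m _ *m P]mulmxA P2 mulmx1
             -[x *m Q *m _ *m P]mulmxA P2 mulmx1.
apply: (inertia_trig At) => [i||y y0|]; first last.
- apply: contraNneq x0 => xP.
  by rewrite -[x]mulmx1 -P2 mulmxA xP mul0mx.
- have := AQ _ (P0 _ y0); rewrite !adjmxM !trmxCK !mulmxA.
  by rewrite -[y *m P *m A *m _ *m P]mulmxA P2 mulmx1.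
- by rewrite !adjmxM trmxCK Qh mulmxA.
apply: A0; pose T := P *m A *m P^t*.
have : eigenvalue T (T i i).
  rewrite eigenvalue_root_char char_poly_trig// rootE horner_prod.
  by rewrite (bigD1 i)//= !hornerE subrr mul0r.
case/eigenvalueP => v vT v0; apply/eigenvalueP; exists (v *m P); last exact: P0.
by rewrite scalemxAl -vT /T !mulmxA -[_ *m P^t* *m P]mulmxA P2 mulmx1.
Qed.

Local Close Scope sesquilinear_scope.

(** * Controller form *)

(* The system [x_i' = x_(i+1)] for [i < k - 1],
   [x_(k-1)' = v - \sum_j a_j x_j], that is [a(D) x_0 = v] for [a] monic of
   degree [k]. *)
Definition chain_mx (F : pzRingType) (k : nat) (a : nat -> F) : 'M[F]_k :=
  \matrix_(i, j) ((j == i.+1 :> nat)%:R - (i.+1 == k)%:R * a j).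

Definition chain_in (F : pzRingType) (k : nat) : 'cV[F]_k :=
  \col_i (i.+1 == k)%:R.

Lemma minimal_annihilator (F : fieldType) (n : nat) (A : 'M[F]_n.+1)
    (B : 'cV[F]_n.+1) :
  exists a : {poly F}, [/\ a \is monic, horner_mx A a *m B = 0 &
    forall q, horner_mx A q *m B = 0 -> (size q < size a)%N -> q = 0].
Proof.
have : exists q, q != 0 /\ horner_mx A q *m B = 0.
  exists (char_poly A); split; first exact/monic_neq0/char_poly_monic.
  by have := Cayley_Hamilton A; rewrite /= => ->; rewrite mul0mx.
case=> q; have [m] := ubnP (size q).
elim: m q => // m IHm q; rewrite ltnS => qm [q0 qB].
have [[r [r0 [rB rq]]]|nr] :=
  EM (exists r, r != 0 /\ horner_mx A r *m B = 0 /\ (size r < size q)%N).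
  by apply: (IHm r) => //; exact: leq_trans rq qm.
have lc0 : (lead_coef q)^-1 != 0 by rewrite invr_eq0 lead_coef_eq0.
exists ((lead_coef q)^-1 *: q); split.
- by rewrite monicE lead_coefZ mulVf// lead_coef_eq0.
- by rewrite linearZ /= -scalemxAl qB scaler0.
- move=> r rB; rewrite size_scale// => rq; apply/eqP; apply: contrapT => r0.
  by apply: nr; exists r; split => //; exact/negP.
Qed.

(* The columns of [M] are the vectors [(a / 'X^(j+1))(A) B] (polynomial
   quotients); they are independent because [a] has minimal degree among the
   annihilators of [B]. *)
Lemma krylov_chain (F : fieldType) (n : nat) (A : 'M[F]_n) (B : 'cV[F]_n) :
  (0 < n)%N ->
  exists (k : nat) (a : {poly F}) (M : 'M[F]_(n, k)) (G : 'M[F]_(k, n)),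
    [/\ a \is monic, size a = k.+1, G *m M = 1%:M,
        A *m M = M *m chain_mx k (fun j => a`_j) & B = M *m chain_in F k].
Proof.
case: n A B => // n A B _.
have [a [a_monic aB a_min]] := minimal_annihilator A B.
have sz_a : size a = (size a).-1.+1.
  by rewrite prednK// lt0n size_poly_eq0 monic_neq0.
move: sz_a; set k := (size a).-1 => sz_a.
pose m j := horner_mx A (drop_poly j.+1 a) *m B.
pose M := \matrix_(i < n.+1, j < k) m j i 0.
have colM j : col j M = m j by apply/colP => i; rewrite !mxE.
have Mv (v : 'cV_k) :
    M *m v = horner_mx A (\sum_j v j 0 *: drop_poly j.+1 a) *m B.
  rewrite linear_sum /= mulmx_suml; apply/colP => i.
  rewrite mxE summxE; apply: eq_bigr => j _.
  by rewrite linearZ /= -scalemxAl !mxE mulrC.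
have dropS j : drop_poly j a = drop_poly j.+1 a * 'X + (a`_j)%:P.
  apply/polyP => i; rewrite coefD coefMX coefC !coef_drop_poly.
  by case: i => [|i] /=; rewrite ?add0r// addr0 addSnnS.
have drop0 : drop_poly 0 a = a.
  by apply/polyP => i; rewrite coef_drop_poly addn0.
have dropk : drop_poly k a = 1.
  apply/polyP => i; rewrite coef_drop_poly coef1.
  case: i => [|i]; last by rewrite nth_default// sz_a; lia.
  by have /monicP := a_monic; rewrite /lead_coef.
(* The companion relation in columns: [A m_j = m_(j-1) - a_j B], where [m_(k-1) = B] and, for
   [j = 0], the first term is [a(A) B = 0]. *)
have Am j : A *m m j = horner_mx A (drop_poly j a) *m B - a`_j *: B.
  rewrite dropS mulrC rmorphD rmorphM /= horner_mx_X horner_mx_C mulmxDl.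
  by rewrite mul_scalar_mx addrK -mulmxE mulmxA.
have sumS j : (j <= k)%N ->
    \sum_(i < k) (i.+1 == j)%:R *: drop_poly i.+1 a =
    if j == 0 then 0 else drop_poly j a.
  case: j => [|j] jk; first by rewrite big1// => i _; rewrite scale0r.
  rewrite (bigD1 (Ordinal jk))//= eqxx scale1r big1 ?addr0// => i ij.
  by rewrite eqSS (negbTE (ij : i != j :> nat)) scale0r.
have free : row_free M^T.
  apply: inj_row_free => v vM; have : M *m v^T = 0.
    by rewrite -[M]trmxK -trmx_mul vM trmx0.
  rewrite Mv; set f := \sum_j _ => fB.
  have f0 : f = 0.
    apply: a_min => //; rewrite sz_a ltnS; apply: leq_trans (size_sum _ _ _) _.
    apply/bigmax_leqP => j _.
    by rewrite (leq_trans (size_scale_leq _ _))// size_drop_poly sz_a subSS leq_subr.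
  apply/rowP => j; rewrite [RHS]mxE.
  have [N] := ubnP j; elim: N j => // N IHN j; rewrite ltnS => jN.
  (* The quotient of index [i] has degree [k - i - 1] and leading coefficient 1, so this coefficient
     of [f] involves [v 0 i] for [i <= j] only: a unitriangular system. *)
  have := congr1 (fun p : {poly F} => p`_(k - j.+1)) f0.
  rewrite coef0 coef_sum (bigD1 j)//= big1 ?addr0 => [|i ij].
    rewrite coefZ coef_drop_poly mxE subnK//.
    by have /monicP := a_monic; rewrite /lead_coef -/k => ->; rewrite mulr1.
  rewrite coefZ coef_drop_poly mxE; have [ltij|leji] := ltnP i j.
    by rewrite IHN ?mul0r// (leq_trans ltij).
  rewrite [_`__]nth_default ?mulr0// sz_a.
  by move: ij; rewrite -val_eqE /=; have := ltn_ord j; lia.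
have [H HM] := row_freeP free.
exists k, a, M, H^T; split => //.
- by rewrite -[M]trmxK -trmx_mul HM trmx1.
- apply/matrixP => i j.
  have -> : (A *m M) i j = (A *m m j) i 0.
    by rewrite -colM colE mulmxA -colE [RHS]mxE.
  have -> : (M *m chain_mx k (fun j => a`_j)) i j =
            (M *m col j (chain_mx k (fun j => a`_j))) i 0.
    by rewrite colE mulmxA -colE [RHS]mxE.
  congr (fun_of_matrix _ i 0); rewrite Am Mv.
  under eq_bigr => l _ do rewrite !mxE scalerBl mulrC -scalerA eq_sym.
  rewrite sumrB -scaler_sumr !sumS// 1?ltnW// dropk.
  have k0 : k != 0 by rewrite -lt0n (leq_trans _ (ltn_ord j)).
  rewrite (negbTE k0) rmorphB /= mulmxBl; congr (_ - _).
    by case: eqP => [->|]//; rewrite drop_poly0l rmorph0 mul0mx.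
  by rewrite linearZ /= rmorph1 -scalemxAl mul1mx.
- rewrite Mv; under eq_bigr => l _ do rewrite mxE.
  rewrite sumS// dropk; case: eqP => [k0|_]; last by rewrite rmorph1 mul1mx.
  rewrite rmorph0 mul0mx -aB -[a]drop_poly0l -[X in drop_poly X]k0 dropk.
  by rewrite rmorph1 mul1mx.
Qed.

(** * Bounded real lemma *)

Definition normsq (R : rcfType) (z : R[i]) : R :=
  complex.Re z ^+ 2 + complex.Im z ^+ 2.

Lemma mul_conjc (R : rcfType) (z : R[i]) :
  z * conjc z = real_complex R (normsq z).
Proof. by case: z => a b; rewrite /normsq; simpc; congr Complex; ring. Qed.

Lemma size_paraconj (R : rcfType) (p : {poly R[i]}) :
  size (paraconj p) = size p.
Proof.
suff le (q : {poly R[i]}) : (size (paraconj q) <= size q)%N.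
  apply/eqP; rewrite eqn_leq le /=; apply: leq_trans (le _).
  rewrite (_ : paraconj (paraconj p) = p)//.
  apply/polyP => i; rewrite !coef_paraconj -!(signr_odd _ i) !mulr_sign.
  by case: odd; rewrite ?raddfN /= conjcK ?opprK.
by apply/leq_sizeP => j qj; rewrite coef_paraconj nth_default// conjc0 mulr0.
Qed.

Lemma eigenvalue_unit (F : fieldType) (n : nat) (A : 'M[F]_n) (z : F) :
  eigenvalue A z = (A - z%:M \notin unitmx).
Proof. by rewrite /eigenvalue kermx_eq0 row_free_unit. Qed.

Lemma eigenvalue_tr (F : fieldType) (n : nat) (A : 'M[F]_n) (z : F) :
  eigenvalue A^T z = eigenvalue A z.
Proof.
by rewrite !eigenvalue_unit -[in RHS]unitmx_tr linearB /= tr_scalar_mx.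
Qed.

(** The cross terms between [u] and [v] are purely imaginary for any real [N]. This carries real
    quadratic inequalities over to the complex setting of [inertia]. *)
Lemma Re_herm (R : rcfType) (n : nat) (N : 'M[R]_n) (x : 'rV[R[i]]_n) :
  let u := map_mx (@complex.Re R) x in let v := map_mx (@complex.Im R) x in
  complex.Re ((x *m map_mx (real_complex R) N *m map_mx Num.conj x^T) 0 0) =
  (u *m N *m u^T) 0 0 + (v *m N *m v^T) 0 0.
Proof.
rewrite /= !mxE (raddf_sum (@complex.Re R : {additive R[i] -> R})) -big_split.
apply: eq_bigr => j _; rewrite !mxE /= !mulr_suml.
rewrite (raddf_sum (@complex.Re R : {additive R[i] -> R})) -big_split.
apply: eq_bigr => i _; rewrite !mxE -[Num.conj _]/(conjc _).
by case: (x 0 i) (x 0 j) => a b [c d] /=; ring.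
Qed.

(** A Kalman-Yakubovich-Popov lemma for the controller form. With [xi = x_0] the state is the jet of
    [xi] up to order [k - 1], [v = a(D) xi] and [\sum_j b_j x_j = b(D) xi]; the left-hand side of
    the last inequality is half the derivative of [x^T P x]. *)
Lemma kyp_chain (R : rcfType) (k : nat) (a b : {poly R}) (g e : R) :
  a \is monic -> size a = k.+1 -> (size b <= k)%N -> 0 < e ->
  (forall w : R, 0 < g ^+ 2 * normsq (map_poly (real_complex R) a).[Complex 0 w]
      - normsq (map_poly (real_complex R) b).[Complex 0 w]
      - e * \sum_(l < k) w ^+ l ^+ 2) ->
  (forall z, eigenvalue (map_mx (real_complex R) (chain_mx k (fun j => a`_j))) z ->
    complex.Re z < 0) ->
  exists P : 'M[R]_k, [/\ P^T = P, forall x : 'cV_k, 0 <= (x^T *m P *m x) 0 0 &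
    forall (x : 'cV_k) (v : R),
      (x^T *m P *m (chain_mx k (fun j => a`_j) *m x + v *: chain_in R k)) 0 0
      <= g ^+ 2 * v ^+ 2 - (\sum_(j < k) b`_j * x j 0) ^+ 2].
Proof.
move=> a_monic sz_a sz_b e0 posw hurw.
pose aC := map_poly (real_complex R) a; pose bC := map_poly (real_complex R) b.
pose rc := real_complex R.
pose p : {poly R[i]} := (rc (g ^+ 2)) *: (aC * paraconj aC) - bC * paraconj bC
  - rc e *: \sum_(l < k) 'X^l * paraconj 'X^l.
have evalE (q : {poly R[i]}) w :
    (q * paraconj q).[Complex 0 w] = rc (normsq q.[Complex 0 w]).
  by rewrite hornerM paraconj_imag mul_conjc.
have normsqX (w : R) l : normsq ((Complex 0 w) ^+ l) = w ^+ l ^+ 2.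
  apply: complexI; rewrite -mul_conjc rmorphXn -exprMn mul_conjc.
  by rewrite /normsq /= expr0n add0r exprAC !rmorphXn.
have p_gt0 w : 0 < p.[Complex 0 w].
  rewrite /p !(hornerD, hornerN, hornerZ) horner_sum !evalE.
  under eq_bigr => l _ do rewrite evalE hornerXn normsqX.
  by rewrite -rmorph_sum -!rmorphM -!rmorphB /= ltcR.
have [d pd] := spectral_factorization p_gt0.
(* [p] has degree at most [2 k], and [d] and [paraconj d] have equal degrees; so [d(D) xi] stays
   within the jet of order [k]. *)
have sz_d : (size d <= k.+1)%N.
  have szaC : size aC = k.+1 by rewrite size_map_poly sz_a.
  have szbC : (size bC <= k)%N by rewrite size_map_poly.
  have d0 : d != 0.
    by apply/eqP => d0; have := p_gt0 0; rewrite pd d0 mul0r horner0 ltxx.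
  have : (size p <= k.*2.+1)%N.
    have szM (q : {poly R[i]}) : (size q <= k.+1)%N ->
        (size (q * paraconj q)%R <= k.*2.+1)%N.
      move=> qk; apply: leq_trans (size_polyMleq _ _) _.
      by rewrite size_paraconj; lia.
    have szB (q r : {poly R[i]}) m : (size q <= m)%N -> (size r <= m)%N ->
        (size (q - r)%R <= m)%N.
      move=> qm rm; apply: leq_trans (size_polyD _ _) _.
      by rewrite geq_max size_polyN qm.
    rewrite /p; apply: (szB); first apply: (szB).
    - by apply: leq_trans (size_scale_leq _ _) _; rewrite szM ?szaC.
    - by rewrite szM// (leq_trans szbC).
    - apply: leq_trans (size_scale_leq _ _) _; apply: leq_trans (size_sum _ _ _) _.
      by apply/bigmax_leqP => l _; rewrite szM// size_polyXn ltnS ltnW.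
  rewrite pd size_mul// ?size_paraconj; last first.
    by rewrite -size_poly_eq0 size_paraconj size_poly_eq0.
  by move: (size d) => sd; rewrite -addnn; lia.
pose th i j := g ^+ 2 * gram aC i j - gram bC i j
  - e * (\sum_(l < k) gram 'X^l i j) - gram d i j.
have th0 i j : ((k < i) || (k < j))%N -> th i j = 0.
  move=> kij; rewrite /th (gram0 _ kij) ?size_map_poly ?sz_a//.
  rewrite (gram0 _ kij) ?size_map_poly ?(leq_trans sz_b)// (gram0 sz_d kij).
  rewrite big1 => [|l _]; first by rewrite !mulr0 !subr0.
  by rewrite (gram0 _ kij)// size_polyXn ltnS ltnW.
have alt m : \sum_(l < m.+1) (-1) ^+ l * th l (m - l)%N = 0.
  have : complex.Re (p - d * paraconj d)`_m = 0 by rewrite -pd subrr coef0.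
  rewrite /p !coefB !coefZ coef_sum !raddfB /= -!gram_alternating.
  have ReZ (r : R) (z : R[i]) : complex.Re (rc r * z) = r * complex.Re z.
    by case: z => x y /=; ring.
  rewrite !ReZ (raddf_sum (@complex.Re R : {additive R[i] -> R})).
  under [in X in _ - e * X]eq_bigr => l _ do rewrite /= -gram_alternating.
  rewrite -gram_alternating exchange_big /= !mulr_sumr -!sumrB => S0.
  rewrite -[RHS]S0; apply: eq_bigr => l _.
  by rewrite /th -mulr_sumr; ring.
have [Psi PsiE] := total_derivative th0 alt.
have Psi_form (x : 'cV_k) (v : R) :
    (x^T *m (Psi + Psi^T) *m
      (chain_mx k (fun j => a`_j) *m x + v *: chain_in R k)) 0 0 <=
    g ^+ 2 * v ^+ 2 - (\sum_(j < k) b`_j * x j 0) ^+ 2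
      - e * \sum_(l < k) x l 0 ^+ 2.
  (* The jet of [xi]: below [k] the state and, at index [k], the default branch, the highest
     derivative given by [a(D) xi = v]. *)
  pose chi i := if insub i is Some j then x j 0 else
    v - \sum_(j < k) a`_j * x j 0.
  have chiE (i : 'I_k) : chi i = x i 0 by rewrite /chi valK.
  have chik : chi k = v - \sum_(j < k) a`_j * x j 0.
    by rewrite /chi insubF// ltnn.
  set y := chain_mx _ _ *m _ + _.
  have yE (i : 'I_k) : y i 0 = chi i.+1.
    rewrite /y !mxE; under eq_bigr => j _ do rewrite !mxE mulrBl.
    rewrite sumrB; have [ik|] := ltnP i.+1 k.
      rewrite (bigD1 (Ordinal ik))//= eqxx mul1r -(chiE (Ordinal ik)) /=.
      rewrite !big1 ?addr0 => [|j _|j].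
      - by rewrite ltn_eqF// mulr0 subr0 addr0.
      - by rewrite ltn_eqF// !mul0r.
      - by rewrite -val_eqE /= => /negbTE ->; rewrite mul0r.
    move=> ki; have ik : i.+1 = k by apply/eqP; rewrite eqn_leq ki ltn_ord.
    rewrite big1 => [|j _]; last by rewrite ik ltn_eqF// mul0r.
    rewrite ik eqxx chik mulr1 sub0r addrC.
    by under eq_bigr => j _ do rewrite mul1r.
  clearbody y.
  have -> : (x^T *m (Psi + Psi^T) *m y) 0 0 =
      \sum_(i < k) \sum_(j < k) Psi i j * (chi i.+1 * chi j + chi i * chi j.+1).
    rewrite mxE; under eq_bigr => j _ do rewrite mxE mulr_suml.
    under eq_bigr => j _ do under eq_bigr => i _ do
      rewrite !mxE mulrDr mulrDl yE -!chiE.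
    under eq_bigr => j _ do rewrite big_split /=.
    under [RHS]eq_bigr => j _ do under eq_bigr => i _ do rewrite mulrDr.
    under [RHS]eq_bigr => j _ do rewrite big_split /=.
    rewrite !big_split /= addrC; congr (_ + _); last rewrite exchange_big /=;
      by apply: eq_bigr => i _; apply: eq_bigr => j _; ring.
  rewrite -PsiE.
  pose Q (f : nat -> nat -> R) :=
    \sum_(i < k.+1) \sum_(j < k.+1) f i j * (chi i * chi j).
  have QB f h : Q (fun i j => f i j - h i j) = Q f - Q h.
    rewrite /Q -sumrB; apply: eq_bigr => i _; rewrite -sumrB.
    by apply: eq_bigr => j _; rewrite mulrBl.
  have QZ c f : Q (fun i j => c * f i j) = c * Q f.
    rewrite /Q mulr_sumr; apply: eq_bigr => i _; rewrite mulr_sumr.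
    by apply: eq_bigr => j _; rewrite mulrA.
  have Qsum (f : 'I_k -> nat -> nat -> R) :
      Q (fun i j => \sum_(l < k) f l i j) = \sum_(l < k) Q (f l).
    rewrite /Q [RHS]exchange_big; apply: eq_bigr => i _ /=.
    rewrite [RHS]exchange_big; apply: eq_bigr => j _ /=.
    by rewrite mulr_suml.
  rewrite -/(Q th) /th 3!QB !QZ Qsum.
  have -> : Q (gram aC) = v ^+ 2.
    rewrite /Q gram_form [X in _ + X ^+ 2]big1 => [|i _]; last first.
      by rewrite coef_map /= mul0r.
    rewrite expr0n addr0 big_ord_recr /= coef_map /= chik.
    have /monicP := a_monic; rewrite /lead_coef sz_a /= => ->; rewrite mul1r.
    under eq_bigr => i _ do rewrite coef_map /= chiE.
    by congr (_ ^+ 2); ring.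
  have -> : Q (gram bC) = (\sum_(j < k) b`_j * x j 0) ^+ 2.
    rewrite /Q gram_form [X in _ + X ^+ 2]big1 => [|i _]; last first.
      by rewrite coef_map /= mul0r.
    rewrite expr0n addr0 big_ord_recr /= coef_map /= [b`_k]nth_default//.
    rewrite mul0r addr0.
    by under eq_bigr => i _ do rewrite coef_map /= chiE.
  have -> : \sum_(l < k) Q (gram 'X^l) = \sum_(l < k) x l 0 ^+ 2.
    apply: eq_bigr => l _; rewrite /Q gram_form.
    have XE i : complex.Re ('X^l : {poly R[i]})`_i = (i == l)%:R /\
                complex.Im ('X^l : {poly R[i]})`_i = 0.
      by rewrite coefXn; case: eqP.
    rewrite [X in _ + X ^+ 2]big1 => [|i _]; last by rewrite (XE i).2 mul0r.
    rewrite expr0n addr0 (bigD1 (widen_ord (leqnSn k) l))//= big1 => [|i il].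
      by rewrite (XE l).1 eqxx mul1r addr0 chiE.
    by rewrite (XE i).1 (negbTE (il : i != l :> nat)) mul0r.
  (* The term dropped is the form of [gram d], a sum of two squares. *)
  by rewrite lerBlDr; rewrite /Q (gram_form d) lerDl addr_ge0// sqr_ge0.
exists (Psi + Psi^T); split.
- by rewrite linearD /= trmxK addrC.
- move=> x; have [->|x0] := eqVneq x 0; first by rewrite mulmx0 mxE.
  pose N := chain_mx k (fun j => a`_j); pose P := Psi + Psi^T.
  have PT : P^T = P by rewrite /P linearD /= trmxK addrC.
  (* Zero input gives a strict Lyapunov inequality; it is transposed because [inertia] acts on row
     vectors. *)
  have neg (u : 'rV[R]_k) :
      (u *m (N^T *m P) *m u^T) 0 0 <= - (e * \sum_(l < k) u 0 l ^+ 2).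
    have := Psi_form u^T 0; rewrite scale0r addr0 expr0n mulr0 sub0r trmxK -/P.
    have -> : (u *m P *m (N *m u^T)) 0 0 = (u *m (N^T *m P) *m u^T) 0 0.
      have tr11 (M : 'M[R]_1) : M 0 0 = M^T 0 0 by rewrite mxE.
      by rewrite [LHS]tr11 !trmx_mul trmxK PT !mulmxA.
    under [in X in _ <= X]eq_bigr => l _ do rewrite mxE.
    under [in X in e * X]eq_bigr => l _ do rewrite mxE.
    by move=> /le_trans; apply; rewrite lerBlDr addNr oppr_le0 sqr_ge0.
  have PTC : map_mx Num.conj (map_mx rc P)^T = map_mx rc P.
    by rewrite map_trmx PT; apply/matrixP => i j; rewrite !mxE -[Num.conj _]/(conjc _) /= oppr0.
  have := @inertia R[i] k (map_mx rc N^T) (map_mx rc P) _ PTC _ (map_mx rc x^T).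
  have c1 z : eigenvalue (map_mx rc N^T) z -> z + z^* < 0.
    rewrite -map_trmx eigenvalue_tr => /hurw z0.
    rewrite -[z^*]/(conjc z) addcJ -(rmorph_nat rc) -rmorphM -(rmorph0 rc) ltcR.
    by rewrite pmulr_rlt0.
  have c3 (y : 'rV[R[i]]_k) : y != 0 ->
      (y *m map_mx rc N^T *m map_mx Num.conj (y *m map_mx rc P)^T) 0 0 +
      ((y *m map_mx rc N^T *m map_mx Num.conj (y *m map_mx rc P)^T) 0 0)^* < 0.
    move=> y0; rewrite adjmxM PTC !mulmxA -[y *m _ *m _]mulmxA -map_mxM /=.
    set z := (_ *m _) 0 0.
    have -> : z + z^* = rc (complex.Re z *+ 2).
      by rewrite -[z^*]/(conjc z); case: z => x1 x2; simpc; rewrite mulr2n.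
    rewrite -(rmorph0 rc) ltcR pmulrn_llt0// /z Re_herm.
    set u := map_mx _ y; set w := map_mx _ y.
    have {y0} : (u != 0) || (w != 0).
      rewrite -negb_and; apply: contra y0 => /andP[/eqP u0 /eqP w0].
      apply/eqP/rowP => i; have := congr1 (fun v : 'rV_k => v 0 i) u0.
      have := congr1 (fun v : 'rV_k => v 0 i) w0; rewrite !mxE.
      by case: (y 0 i) => a1 a2 /= -> ->.
    have sq_ge0 (r : 'rV[R]_k) : 0 <= e * \sum_(l < k) r 0 l ^+ 2.
      by rewrite mulr_ge0 ?(ltW e0)// sumr_ge0// => l _; rewrite sqr_ge0.
    have sq_gt0 (r : 'rV[R]_k) : r != 0 -> 0 < e * \sum_(l < k) r 0 l ^+ 2.
      move=> /rV0Pn[j rj]; rewrite mulr_gt0// (bigD1 j)//= ltr_pwDl//.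
        by rewrite exprn_even_gt0.
      by rewrite sumr_ge0// => l _; rewrite sqr_ge0.
    have := neg u; have := neg w; have := sq_ge0 u; have := sq_ge0 w.
    by move=> w1 u1 w2 u2 /orP[/sq_gt0|/sq_gt0]; lra.
  have xC0 : map_mx rc x^T != 0.
    apply: contra x0 => /eqP xC; apply/eqP/colP => i.
    by have := congr1 (fun v : 'rV_k => v 0 i) xC; rewrite !mxE => -[].
  move=> /(_ c1 c3 xC0); rewrite ltcE => /andP[_]; rewrite Re_herm.
  have -> : map_mx (@complex.Re R) (map_mx rc x^T) = x^T.
    by apply/matrixP => i j; rewrite !mxE.
  have -> : map_mx (@complex.Im R) (map_mx rc x^T) = 0.
    by apply/matrixP => i j; rewrite !mxE.
  by rewrite !mul0mx [(0 : 'M[R]_1) _ _]mxE addr0 trmxK => /ltW.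
- move=> x v; apply: le_trans (Psi_form x v) _; rewrite lerBlDr lerDl.
  by rewrite mulr_ge0 ?(ltW e0)// sumr_ge0// => l _; rewrite sqr_ge0.
Qed.

(** * Frequency response of the controller form *)

(** Serves at a root of [a], where the column of powers is an eigenvector, and at [s = i w], where
    it yields [(s - A)^-1 B = M V / a(s)] and hence [H = b / a]. *)
Lemma chain_mx_vandermonde (F : comNzRingType) (k : nat) (a : {poly F}) (s : F) :
  a \is monic -> size a = k.+1 ->
  chain_mx k (fun j => a`_j) *m (\col_(i < k) s ^+ i) =
  s *: (\col_(i < k) s ^+ i) - a.[s] *: chain_in F k.
Proof.
move=> a_monic sz_a; apply/colP => i; rewrite !mxE.
under eq_bigr => j _ do rewrite !mxE mulrBl.
rewrite sumrB; have [ik|] := ltnP i.+1 k.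
  rewrite (bigD1 (Ordinal ik))//= eqxx mul1r.
  rewrite !big1 ?addr0 => [|j _|j].
  - by rewrite ltn_eqF// mulr0 -exprS.
  - by rewrite ltn_eqF// !mul0r.
  - by rewrite -val_eqE /= => /negbTE ->; rewrite mul0r.
move=> ki; have ik : i.+1 = k by apply/eqP; rewrite eqn_leq ki ltn_ord.
rewrite big1 => [|j _]; last by rewrite ik ltn_eqF// mul0r.
rewrite ik eqxx mulr1 sub0r -exprS ik horner_coef sz_a big_ord_recr /=.
have /monicP := a_monic; rewrite /lead_coef sz_a /= => ->.
by under eq_bigr => j _ do rewrite mul1r; rewrite mul1r opprD addrCA subrr addr0.
Qed.

Lemma normsqM (R : rcfType) (x y : R[i]) :
  normsq (x * y) = normsq x * normsq y.
Proof. by case: x y => a b [c d]; rewrite /normsq /=; ring. Qed.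

Lemma normsq_ge0 (R : rcfType) (x : R[i]) : 0 <= normsq x.
Proof. by rewrite addr_ge0// sqr_ge0. Qed.

(** Each factor is at least a multiple of [1 + w^2], since its root is off the axis. The full growth
    rate is what lets a single [e] work at all [w] in the frequency inequality. *)
Lemma normsq_prod_ge (R : rcfType) (rs : seq R[i]) :
  (forall z, z \in rs -> complex.Re z != 0) ->
  exists2 e : R, 0 < e & forall w, e * (1 + w ^+ 2) ^+ size rs <=
    normsq (\prod_(z <- rs) ('X - z%:P)).[Complex 0 w].
Proof.
elim: rs => [_|z rs IH zrs].
  exists 1 => // w; rewrite big_nil hornerC expr0 mulr1 /normsq /=.
  by rewrite expr1n expr0n addr0.
have [|e e0 He] := IH; first by move=> y yrs; apply: zrs; rewrite inE yrs orbT.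
have := zrs z (mem_head _ _); case: z {zrs} => x y /= x0.
have x2 : 0 < x ^+ 2 by rewrite exprn_even_gt0.
(* [1 + w^2 <= 1 + 2 y^2 + 2 (w - y)^2 <= D (x^2 + (w - y)^2)] *)
pose D := (1 + 2 * y ^+ 2) / x ^+ 2 + 2.
have D0 : 0 < D.
  by rewrite ltr_wpDl// divr_ge0 ?(ltW x2)// addr_ge0// mulr_ge0// sqr_ge0.
exists (D^-1 * e) => [|w]; first by rewrite mulr_gt0// invr_gt0.
rewrite big_cons hornerM normsqM exprS mulrACA ler_pM//.
- by rewrite mulr_ge0 ?invr_ge0 ?(ltW D0)// addr_ge0// sqr_ge0.
- by rewrite mulr_ge0 ?(ltW e0)// exprn_ge0// addr_ge0// sqr_ge0.
rewrite ler_pdivrMl// !hornerE /normsq /= sub0r sqrrN.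
have -> : D * (x ^+ 2 + (w - y) ^+ 2) =
    (1 + 2 * y ^+ 2) + 2 * x ^+ 2 + (1 + 2 * y ^+ 2) / x ^+ 2 * (w - y) ^+ 2
    + 2 * (w - y) ^+ 2.
  by rewrite /D; field; rewrite -sqrf_eq0 gt_eqF.
have h1 : 0 <= (1 + 2 * y ^+ 2) / x ^+ 2 * (w - y) ^+ 2.
  by rewrite mulr_ge0 ?sqr_ge0// divr_ge0 ?(ltW x2)// addr_ge0// mulr_ge0// sqr_ge0.
(* [(w - 2 y)^2 = 2 y^2 + 2 (w - y)^2 - w^2]. *)
have h2 := sqr_ge0 (w - 2 * y); nra.
Qed.

(** Against the lower bound on [a] this bounds [|H(i w)|], so that [transfer_norm] is the supremum
    of a bounded set and dominates each value. *)
Lemma normsq_poly_le (R : rcfType) (k : nat) (p : {poly R[i]}) :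
  (size p <= k.+1)%N ->
  exists2 D : R, 0 <= D & forall w, normsq p.[Complex 0 w] <= D * (1 + w ^+ 2) ^+ k.
Proof.
elim: k p => [|k IH] p pk.
  exists (normsq p`_0); first exact: normsq_ge0.
  by move=> w; rewrite [p in p.[_]]size1_polyC// hornerC expr0 mulr1.
have [|D D0 HD] := IH (drop_poly 1 p).
  by rewrite size_drop_poly leq_subLR add1n.
exists (2 * D + 2 * normsq p`_0) => [|w].
  by rewrite addr_ge0// mulr_ge0// normsq_ge0.
have pE : p = drop_poly 1 p * 'X + (p`_0)%:P.
  apply/polyP => i; rewrite coefD coefMX coefC coef_drop_poly.
  by case: i => [|i] /=; rewrite ?add0r// addr0 addn1.
rewrite [in leLHS]pE !(hornerD, hornerM, hornerX, hornerC).
set z := _.[_].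
have H : normsq z * w ^+ 2 <= D * (1 + w ^+ 2) ^+ k.+1.
  have -> : D * (1 + w ^+ 2) ^+ k.+1 = D * (1 + w ^+ 2) ^+ k * (1 + w ^+ 2).
    by rewrite exprSr mulrA.
  by apply: ler_pM; rewrite ?HD ?normsq_ge0 ?sqr_ge0// lerDr.
have H1 : 1 <= (1 + w ^+ 2) ^+ k.+1 by rewrite exprn_ege1// lerDl sqr_ge0.
have N (x y : R[i]) : normsq (x + y) <= 2 * normsq x + 2 * normsq y.
  case: x y => a b [c d]; rewrite /normsq /=.
  by have := sqr_ge0 (a - c); have := sqr_ge0 (b - d); nra.
apply: le_trans (N _ _) _; rewrite [leRHS]mulrDl lerD//.
  rewrite normsqM -!mulrA ler_wpM2l//; apply: le_trans H.
  by rewrite /normsq /= expr0n add0r.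
by rewrite -mulrA ler_wpM2l// ler_peMr// normsq_ge0.
Qed.

Lemma eigenvalue_colP (F : fieldType) (n : nat) (A : 'M[F]_n) (z : F) :
  reflect (exists2 v : 'cV_n, v != 0 & A *m v = z *: v) (eigenvalue A z).
Proof.
rewrite -eigenvalue_tr; apply: (iffP eigenvalueP) => [[v vz v0]|[v v0 vz]].
  exists v^T; first by rewrite -trmx0 (can_eq (@trmxK _ _ _)).
  by apply: trmx_inj; rewrite trmx_mul trmxK vz linearZ /= trmxK.
exists v^T; last by rewrite -trmx0 (can_eq (@trmxK _ _ _)).
by rewrite -trmx_mul vz linearZ.
Qed.

Lemma normcE_normsq (R : rcfType) (z : R[i]) :
  ComplexField.Normc.normc z = Num.sqrt (normsq z).
Proof. by case: z. Qed.

(** On the axis [|b|^2 <= T^2 |a|^2] with [T] the norm, and the gap [(g^2 - T^2) |a|^2] absorbs the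
    slack because [|a|^2] is at least a multiple of [(1 + w^2)^k]. The coefficients of [b] are the
    entries of [K M], the output read in chain coordinates. *)
Lemma chain_frequency_bound (R : realType) (n k : nat) (A : 'M[R]_n)
    (B : 'cV[R]_n) (K : 'rV[R]_n) (a : {poly R}) (M : 'M[R]_(n, k))
    (G : 'M[R]_(k, n)) (g : R) :
  hurwitz A -> transfer_norm A B K < g ->
  a \is monic -> size a = k.+1 -> G *m M = 1%:M ->
  A *m M = M *m chain_mx k (fun j => a`_j) -> B = M *m chain_in R k ->
  let b := \poly_(j < k) (if insub j is Some i then (K *m M) 0 i else 0) in
  (exists2 e, 0 < e & forall w : R,
    0 < g ^+ 2 * normsq (map_poly (real_complex R) a).[Complex 0 w]
      - normsq (map_poly (real_complex R) b).[Complex 0 w]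
      - e * \sum_(l < k) w ^+ l ^+ 2) /\
  (forall z, eigenvalue (map_mx (real_complex R) (chain_mx k (fun j => a`_j))) z ->
    complex.Re z < 0).
Proof.
move=> hA Tg a_monic sz_a GM AM BM b.
pose aC := map_poly (real_complex R) a; pose bC := map_poly (real_complex R) b.
pose MC := map_mx (real_complex R) M; pose AC := map_mx (real_complex R) A.
have aC_monic : aC \is monic by rewrite map_monic.
have sz_aC : size aC = k.+1 by rewrite size_map_poly.
have chainC : map_mx (real_complex R) (chain_mx k (fun j => a`_j)) = chain_mx k (fun j => aC`_j).
  apply/matrixP => i j; rewrite !mxE rmorphB rmorphM !rmorph_nat.
  by rewrite coef_map.
have AMC : AC *m MC = MC *m chain_mx k (fun j => aC`_j).
  by rewrite -chainC -!map_mxM AM.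
have BMC : map_mx (real_complex R) B = MC *m chain_in R[i] k.
  rewrite BM map_mxM; congr (_ *m _).
  by apply/matrixP => i j; rewrite !mxE rmorph_nat.
(* [M] intertwines the chain with [A] and is injective, so it maps eigenvectors to eigenvectors of
   [A]. *)
have hurw z (v : 'cV_k) : v != 0 -> chain_mx k (fun j => aC`_j) *m v = z *: v ->
    complex.Re z < 0.
  move=> v0 vz; apply: hA; apply/eigenvalue_colP; exists (MC *m v).
    apply: contra v0 => /eqP Mv0; rewrite -[v]mul1mx -(map_mx1 (real_complex R)) -GM map_mxM.
    by rewrite -mulmxA Mv0 mulmx0.
  by rewrite mulmxA AMC -mulmxA vz -scalemxAr.
split; last first.
  by move=> z; rewrite chainC => /eigenvalue_colP[v v0 vz]; exact: (hurw _ v).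
pose V s : 'cV[R[i]]_k := \col_(i < k) s ^+ i.
have root_lt0 z : root aC z -> complex.Re z < 0.
  move=> az; apply: (hurw _ (V z)).
    apply/eqP => /colP V0.
    have k0 : k = 0.
      have [//|kgt0] := posnP k; have := V0 (Ordinal kgt0).
      by rewrite !mxE /= expr0 => /eqP; rewrite oner_eq0.
    move: az; rewrite (size1_polyC (_ : size aC <= 1)%N) ?sz_aC ?k0//.
    rewrite rootC => aC0; move: aC_monic; rewrite monicE lead_coefE sz_aC k0 /=.
    by rewrite (eqP aC0) eq_sym oner_eq0.
  by rewrite chain_mx_vandermonde// (eqP az) scale0r subr0.
have transferE w : transfer A B K (Complex 0 w) * aC.[Complex 0 w] =
    bC.[Complex 0 w].
  set s := Complex 0 w.
  have su : s%:M - AC \in unitmx.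
    rewrite -opprB -scaleN1r unitmxZ ?unitrN1//; apply: contraT => nu.
    suff /hA : eigenvalue (mx_complex A) s by rewrite /= ltxx.
    by rewrite eigenvalue_unit.
  have sMV : (s%:M - AC) *m (MC *m V s) = aC.[s] *: map_mx (real_complex R) B.
    rewrite mulmxBl mul_scalar_mx mulmxA AMC -mulmxA chain_mx_vandermonde//.
    by rewrite mulmxBr -!scalemxAr opprB addrCA subrr addr0 BMC.
  have -> : bC.[s] = (map_mx (real_complex R) K *m (MC *m V s)) 0 0.
    rewrite mulmxA -map_mxM mxE (@horner_coef_wide _ k); last first.
      by rewrite size_map_poly size_poly.
    apply: eq_bigr => j _; rewrite coef_map coef_poly ltn_ord valK.
    by rewrite [map_mx _ _ _ _]mxE [V s _ _]mxE.
  rewrite -[MC *m V s](mulKmx su) sMV -scalemxAr -scalemxAr mxE mulrC.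
  by rewrite /transfer mulmxA.
have [rs aCE] := closed_field_poly_normal aC.
move: aCE; rewrite (monicP aC_monic) scale1r => aCE.
have sz_rs : size rs = k.
  by apply: succn_inj; rewrite -sz_aC aCE size_prod_XsubC.
have [z zrs|e e0] := normsq_prod_ge (rs := rs).
  by rewrite lt_eqF// root_lt0// aCE root_prod_XsubC.
rewrite -aCE sz_rs => aC_ge.
have [|D D0 bC_le] := @normsq_poly_le R k bC.
  by rewrite size_map_poly ltnW// ltnS size_poly.
have w2_gt0 (w : R) m : 0 < (1 + w ^+ 2) ^+ m.
  by rewrite exprn_gt0// ltr_pwDl// sqr_ge0.
have aC_gt0 w : 0 < normsq aC.[Complex 0 w].
  by apply: lt_le_trans (aC_ge w); rewrite mulr_gt0.
pose S := [set ComplexField.Normc.normc (transfer A B K (Complex 0 w))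
      | w in `[0, +oo[ : set R].
have transfer_normsq w : normsq (transfer A B K (Complex 0 w)) =
    normsq bC.[Complex 0 w] / normsq aC.[Complex 0 w].
  by rewrite -transferE normsqM mulfK// gt_eqF.
have S_ub : has_ubound S.
  exists (Num.sqrt (D / e)) => _ [w _ <-]; rewrite normcE_normsq ler_wsqrtr//.
  rewrite transfer_normsq ler_pdivrMr// mulrAC ler_pdivlMr//.
  rewrite (le_trans (ler_wpM2r (ltW e0) (bC_le w)))//.
  by rewrite -mulrA ler_wpM2l// mulrC.
have Sw w : 0 <= w -> Num.sqrt (normsq (transfer A B K (Complex 0 w))) <= transfer_norm A B K.
  move=> w0; rewrite -normcE_normsq; apply: ub_le_sup => //; exists w => //.
  by rewrite /= in_itv /= w0.
set T := transfer_norm A B K in Tg Sw.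
have T0 : 0 <= T by apply: le_trans (Sw 0 (lexx _)); exact: sqrtr_ge0.
have bCT w : normsq bC.[Complex 0 w] <= T ^+ 2 * normsq aC.[Complex 0 w].
  (* The norm only sees [w >= 0]; real coefficients make the moduli even in [w]. *)
  wlog w0 : w / 0 <= w => [IH|].
    have [|/ltW w0] := leP 0 w; first exact: IH.
    have negE (q : {poly R}) : normsq (map_poly (real_complex R) q).[Complex 0 w] =
        normsq (map_poly (real_complex R) q).[Complex 0 (- w)].
      have -> : Complex 0 (- w) = conjc (Complex 0 w) by [].
      have qq : map_poly (real_complex R) q = map_poly conjc (map_poly (real_complex R) q).
        by apply/polyP => i; rewrite !coef_map /= oppr0.
      rewrite [in RHS]qq (horner_map (@conjc R)).
      by case: (_.[_]) => x y; rewrite /normsq /= sqrrN.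
    by rewrite /bC /aC !negE; apply: IH; rewrite oppr_ge0.
  rewrite -ler_pdivrMr// -transfer_normsq -[leLHS]sqr_sqrtr ?normsq_ge0//.
  by rewrite lerXn2r ?nnegrE ?sqrtr_ge0// Sw.
have gT : 0 < g ^+ 2 - T ^+ 2.
  by rewrite subr_gt0 ltrXn2r// ?nnegrE//; apply: ltW; exact: le_lt_trans Tg.
(* Each of the [k] powers is at most [(1 + w^2)^k]; dividing by [k + 1] keeps the inequality strict,
   also for [k = 0]. *)
pose d := (g ^+ 2 - T ^+ 2) * e / k.+1%:R.
have d0 : 0 < d by rewrite divr_gt0 ?mulr_gt0.
exists d => // w; rewrite -/aC -/bC.
have : d * \sum_(l < k) w ^+ l ^+ 2 < (g ^+ 2 - T ^+ 2) * normsq aC.[Complex 0 w].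
  apply: (@lt_le_trans _ _ ((g ^+ 2 - T ^+ 2) * e * (1 + w ^+ 2) ^+ k)).
    rewrite /d -mulrA ltr_pM2l ?mulr_gt0// ltr_pdivrMl//.
    apply: (@le_lt_trans _ _ (\sum_(l < k) (1 + w ^+ 2) ^+ k)); last first.
      by rewrite sumr_const card_ord -[ltLHS]mulr_natl ltr_pM2r// ltr_nat.
    apply: ler_sum => l _; rewrite -exprM mulnC exprM.
    apply: (@le_trans _ _ ((1 + w ^+ 2) ^+ l)).
      by rewrite lerXn2r ?nnegrE ?sqr_ge0 ?addr_ge0 ?sqr_ge0// lerDr.
    by rewrite ler_weXn2l ?lerDl ?sqr_ge0// ltnW.
  by rewrite -mulrA ler_pM2l.
have := bCT w; lra.
Qed.

(* [N] is a projection vanishing on the Krylov space of [B], and [x^T P x] is a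
   storage function on that space. *)
Lemma bounded_real (R : realType) (n : nat) (A : 'M[R]_n) (B : 'cV[R]_n)
    (K : 'rV[R]_n) (g : R) :
  (0 < n)%N -> hurwitz A -> transfer_norm A B K < g ->
  exists (N P : 'M[R]_n), [/\ N *m B = 0, N *m A = N *m A *m N, P^T = P,
    forall x : 'cV_n, 0 <= (x^T *m P *m x) 0 0 &
    forall (x : 'cV_n) (v : R), N *m x = 0 ->
      (x^T *m P *m (A *m x + v *: B)) 0 0 <= g ^+ 2 * v ^+ 2 - (K *m x) 0 0 ^+ 2].
Proof.
move=> n0 hA Tg.
have [k [a [M [G [a_monic sz_a GM AM BM]]]]] := krylov_chain A B n0.
have [[e e0 freq] hurw] := chain_frequency_bound hA Tg a_monic sz_a GM AM BM.
have [|P [PT P0 PK]] := kyp_chain a_monic sz_a _ e0 freq hurw.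
  exact: size_poly.
exists (1%:M - M *m G), (G^T *m P *m G); split.
- by rewrite mulmxBl mul1mx BM -mulmxA [G *m _]mulmxA GM mul1mx subrr.
- have NM : (1%:M - M *m G) *m M = 0.
    by rewrite mulmxBl mul1mx -mulmxA GM mulmx1 subrr.
  rewrite [RHS]mulmxBr mulmx1 mulmxA -[_ *m A *m M]mulmxA AM [_ *m (M *m _)]mulmxA.
  by rewrite NM !mul0mx subr0.
- by rewrite !trmx_mul trmxK PT mulmxA.
- by move=> x; have := P0 (G *m x); rewrite trmx_mul !mulmxA.
(* [N x = 0] means [x = M (G x)]: [G x] is the vector of chain coordinates of [x]. *)
move=> x v; rewrite mulmxBl mul1mx => /eqP; rewrite subr_eq0 => /eqP xE.
have := PK (G *m x) v.
have -> : \sum_(j < k) (\poly_(j < k) (if insub j is Some i then (K *m M) 0 i else 0))`_j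
    * (G *m x) j 0 = (K *m x) 0 0.
  rewrite [in RHS]xE -[M *m G *m x]mulmxA [K *m (M *m _)]mulmxA [RHS]mxE; apply: eq_bigr => j _.
  by rewrite coef_poly ltn_ord valK.
have -> : A *m x + v *: B =
    M *m (chain_mx k (fun j => a`_j) *m (G *m x) + v *: chain_in R k).
  by rewrite mulmxDr mulmxA -AM -scalemxAr -BM -mulmxA [in M *m _]mulmxA -xE.
move=> /(le_trans _); apply; rewrite trmx_mul !mulmxA -[_ *m G *m M]mulmxA GM.
by rewrite mulmx1.
Qed.

(** * Primitives *)

Definition seg_integrable (R : realType) (a b : R) (f : R -> R) : Prop :=
  (@lebesgue_measure R).-integrable `[a, b] (EFin \o f).

Lemma seg_integrableS (R : realType) (a b c d : R) (f : R -> R) :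
  a <= c -> d <= b -> seg_integrable a b f -> seg_integrable c d f.
Proof.
move=> ac db; apply: integrableS => //.
by apply: subset_itv; rewrite bnd_simp.
Qed.

Lemma seg_integrable_within (R : realType) (a b : R) (f : R -> R) :
  {within `[a, b], continuous f} -> seg_integrable a b f.
Proof. by apply: continuous_compact_integrable; exact: segment_compact. Qed.

Lemma seg_integrableD (R : realType) (a b : R) (f g : R -> R) :
  seg_integrable a b f -> seg_integrable a b g ->
  seg_integrable a b (fun x => f x + g x).
Proof.
move=> fi gi; rewrite /seg_integrable.
rewrite (_ : EFin \o _ = (EFin \o f) \+ (EFin \o g))%E//.
exact: integrableD.
Qed.

Lemma seg_integrableN (R : realType) (a b : R) (f : R -> R) :
  seg_integrable a b f -> seg_integrable a b (fun x => - f x).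
Proof.
move=> fi.
rewrite /seg_integrable.
rewrite (_ : EFin \o _ = \- (EFin \o f))%E//.
apply: integrableN => //.
Qed.

Lemma seg_integrableB (R : realType) (a b : R) (f g : R -> R) :
  seg_integrable a b f -> seg_integrable a b g ->
  seg_integrable a b (fun x => f x - g x).
Proof. by move=> fi gi; apply: seg_integrableD => //; exact: seg_integrableN. Qed.

Lemma seg_integrable_norm (R : realType) (a b : R) (f : R -> R) :
  seg_integrable a b f -> seg_integrable a b (fun x => `|f x|).
Proof. exact: integrable_norm. Qed.

Lemma seg_integrableM (R : realType) (a b : R) (f g : R -> R) :
  seg_integrable a b f -> {within `[a, b], continuous g} ->
  seg_integrable a b (fun x => f x * g x).
Proof.
move=> fi cg; rewrite /seg_integrable.
rewrite (_ : EFin \o _ = (EFin \o f) \* (EFin \o g))%E//.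
apply: integrableMl => //.
  by exact: subspace_continuous_measurable_fun.
have /compact_bounded := continuous_compact cg (@segment_compact R a b).
by move=> [M [Mr HM]]; exists M; split => // y My x abx; apply: HM => //; exists x.
Qed.

Lemma seg_integrable_sum (R : realType) (a b : R) (I : Type) (s : seq I)
    (F : I -> R -> R) :
  (forall i, seg_integrable a b (F i)) ->
  seg_integrable a b (fun x => \sum_(i <- s) F i x).
Proof.
move=> Fi; elim: s => [|i s IHs].
  under [X in seg_integrable _ _ X]eq_fun do rewrite big_nil.
  by apply: seg_integrable_within => x; exact: cvg_cst.
under [X in seg_integrable _ _ X]eq_fun do rewrite big_cons.
exact: seg_integrableD.
Qed.

Definition prim (R : realType) (a : R) (f : R -> R) (t : R) : R :=
  \int[@lebesgue_measure R]_(x in `[a, t]) f x.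

Lemma prim_sum (R : realType) (a b : R) (I : Type) (s : seq I) (F : I -> R -> R) :
  (forall i, seg_integrable a b (F i)) ->
  prim a (fun x => \sum_(i <- s) F i x) b = \sum_(i <- s) prim a (F i) b.
Proof.
move=> Fi; rewrite /prim; elim: s => [|i s IHs].
  under eq_Rintegral do rewrite big_nil.
  by rewrite big_nil Rintegral_cst// mul0r.
under eq_Rintegral do rewrite big_cons.
by rewrite big_cons RintegralD// ?IHs//; [exact: Fi|exact: seg_integrable_sum].
Qed.

Lemma primB (R : realType) (a s t : R) (f : R -> R) :
  a <= s -> s <= t -> seg_integrable a t f ->
  prim a f t - prim a f s = prim s f t.
Proof.
move=> as_ st fi; rewrite /prim Rintegral_itvB// Rintegral_itv_obnd_cbnd//.
by apply: integrableS fi => //; apply: subset_itvScc; rewrite // bnd_simp.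
Qed.

(* Bisecting in the values of [Phi] halves the bound at each step. *)
Lemma quadratic_increment_eq (R : realType) (D Phi : R -> R) (a b : R) :
  a <= b -> {within `[a, b], continuous Phi} ->
  (forall s t, a <= s -> s <= t -> t <= b ->
    `|D t - D s| <= (Phi t - Phi s) ^+ 2) ->
  D b = D a.
Proof.
move=> ab cPhi DPhi.
have bis m : forall s t, a <= s -> s <= t -> t <= b ->
    `|D t - D s| <= (Phi t - Phi s) ^+ 2 / 2 ^+ m.
  elim: m => [|m IHm] s t as_ st tb; first by rewrite expr0 divr1 DPhi.
  have [||r] := @IVT R Phi s t ((Phi s + Phi t) / 2) st.
  - apply: continuous_subspaceW cPhi.
    by apply: subset_itvScc; rewrite bnd_simp.
  - by have [h|h] := leP (Phi s) (Phi t); apply/andP; split; lra.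
  rewrite in_itv /= => /andP[sr rt] Phir.
  rewrite (_ : D t - D s = (D t - D r) + (D r - D s)); last by ring.
  apply: le_trans (ler_normD _ _) _.
  have H1 := IHm r t (le_trans as_ sr) rt tb.
  have H2 := IHm s r as_ sr (le_trans rt tb).
  apply: le_trans (lerD H1 H2) _; rewrite Phir -mulrDl [2 ^+ m.+1]exprS invfM.
  rewrite mulrA ler_wpM2r ?invr_ge0 ?exprn_ge0//.
  by rewrite le_eqVlt; apply/orP; left; apply/eqP; field.
apply/eqP; rewrite -subr_eq0 -normr_le0; apply/ler_addgt0Pl => e e0.
rewrite addr0; pose C := (Phi b - Phi a) ^+ 2.
have [m Cm] : exists m, C / e <= 2 ^+ m.
  have [m Hm] : exists m : nat, C / e <= m%:R.
    by exists (Num.truncn (C / e)).+1; rewrite ltW// truncnS_gt.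
  exists m; apply: le_trans Hm _; rewrite -natrX ler_nat.
  by rewrite ltnW// ltn_expl.
apply: le_trans (bis m a b (lexx _) ab (lexx _)) _.
by rewrite ler_pdivrMr ?exprn_gt0// mulrC -ler_pdivrMr.
Qed.

Lemma prim_refl (R : realType) (a : R) (f : R -> R) : prim a f a = 0.
Proof. by rewrite /prim set_itv1 Rintegral_set1. Qed.

Lemma prim_continuous (R : realType) (a b : R) (f : R -> R) :
  a <= b -> seg_integrable a b f -> {within `[a, b], continuous (prim a f)}.
Proof. by move=> ab fi; have := parameterized_integral_continuous ab fi. Qed.

Lemma eq_prim (R : realType) (a t : R) (f g : R -> R) :
  (forall x, a <= x <= t -> f x = g x) -> prim a f t = prim a g t.
Proof.
by move=> fg; apply: eq_Rintegral => x; rewrite inE /= in_itv /= => /fg.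
Qed.

Lemma le_prim (R : realType) (a t : R) (f g : R -> R) :
  seg_integrable a t f -> seg_integrable a t g ->
  (forall x, a <= x <= t -> f x <= g x) -> prim a f t <= prim a g t.
Proof.
by move=> fi gi fg; apply: le_Rintegral => // x; rewrite /= in_itv /= => /fg.
Qed.

Lemma prim_ge0 (R : realType) (a t : R) (f : R -> R) :
  (forall x, a <= x <= t -> 0 <= f x) -> 0 <= prim a f t.
Proof.
by move=> f0; apply: Rintegral_ge0 => x; rewrite /= in_itv /= => /f0.
Qed.

Lemma primD (R : realType) (a t : R) (f g : R -> R) :
  seg_integrable a t f -> seg_integrable a t g ->
  prim a (fun x => f x + g x) t = prim a f t + prim a g t.
Proof. by move=> fi gi; rewrite /prim RintegralD. Qed.

Lemma prim_sub (R : realType) (a t : R) (f g : R -> R) :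
  seg_integrable a t f -> seg_integrable a t g ->
  prim a (fun x => f x - g x) t = prim a f t - prim a g t.
Proof. by move=> fi gi; rewrite /prim RintegralB. Qed.

Lemma primZl (R : realType) (a t k : R) (f : R -> R) :
  seg_integrable a t f -> prim a (fun x => k * f x) t = k * prim a f t.
Proof. by move=> fi; rewrite /prim RintegralZl. Qed.

Lemma primZr (R : realType) (a t k : R) (f : R -> R) :
  seg_integrable a t f -> prim a (fun x => f x * k) t = prim a f t * k.
Proof. by move=> fi; rewrite /prim RintegralZr. Qed.

Lemma ler_norm_prim (R : realType) (a t : R) (f : R -> R) :
  seg_integrable a t f -> `|prim a f t| <= prim a (fun x => `|f x|) t.
Proof. by move=> fi; exact: le_normr_Rintegral. Qed.

Lemma le_prim_seg (R : realType) (a s t : R) (f : R -> R) :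
  a <= s -> s <= t -> seg_integrable a t f ->
  (forall x, a <= x <= t -> 0 <= f x) -> prim s f t <= prim a f t.
Proof.
move=> as_ st fi f0; rewrite -(primB as_ st fi) gerBl.
by apply: prim_ge0 => x /andP[ax xs]; apply: f0; rewrite ax (le_trans xs).
Qed.

Lemma seg_integrable_cst (R : realType) (a b k : R) :
  seg_integrable a b (fun=> k).
Proof. by apply: seg_integrable_within => x; exact: cvg_cst. Qed.

Lemma seg_integrableZl (R : realType) (a b k : R) (f : R -> R) :
  seg_integrable a b f -> seg_integrable a b (fun x => k * f x).
Proof.
move=> fi; under [X in seg_integrable _ _ X]eq_fun do rewrite mulrC.
by apply: seg_integrableM => // x; exact: cvg_cst.
Qed.

(* [f] and [g] are only integrable.  The two sides, as functions of [b], differ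
   over [s, t] by at most the square of the increment of [\int (|f| + |g|)]. *)
Lemma prim_product (R : realType) (a b : R) (f g : R -> R) :
  a <= b -> seg_integrable a b f -> seg_integrable a b g ->
  prim a (fun x => f x * prim a g x + g x * prim a f x) b =
  prim a f b * prim a g b.
Proof.
move=> ab fi gi; set F := prim a f; set G := prim a g.
have Fc : {within `[a, b], continuous F} by exact: prim_continuous.
have Gc : {within `[a, b], continuous G} by exact: prim_continuous.
pose h x := f x * G x + g x * F x.
have hi : seg_integrable a b h by apply: seg_integrableD; exact: seg_integrableM.
have phii : seg_integrable a b (fun x => `|f x| + `|g x|).
  by apply: seg_integrableD; exact: seg_integrable_norm.
pose D t := F t * G t - prim a h t.
suff : D b = D a.
  rewrite /D /F /G !prim_refl mulr0 subr0 => /eqP; rewrite subr_eq0 => /eqP ->.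
  by [].
apply: (@quadratic_increment_eq _ D (prim a (fun x => `|f x| + `|g x|)) _ _ ab).
  exact: prim_continuous.
move=> s t as_ st tb.
have S p : seg_integrable a b p -> seg_integrable s t p.
  exact: seg_integrableS.
have At p : seg_integrable a b p -> seg_integrable a t p.
  exact: seg_integrableS.
have Fst : F t - F s = prim s f t by apply: primB => //; exact: At.
have Gst : G t - G s = prim s g t by apply: primB => //; exact: At.
have hst : prim a h t - prim a h s = prim s h t by apply: primB => //; exact: At.
(* From [F t * G t - F s * G s = (F t - F s) * G t + F s * (G t - G s)]: with the primitives frozen
   at opposite ends, only their increments inside [[s, t]] remain after subtracting [h]. *)
have -> : D t - D s =
    prim s (fun x => (f x * G t + g x * F s) - h x) t.
  rewrite prim_sub; [|apply: seg_integrableD|exact: S]; first last.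
  - by apply: seg_integrableM (S _ gi) _ => x; exact: cvg_cst.
  - by apply: seg_integrableM (S _ fi) _ => x; exact: cvg_cst.
  rewrite primD; first last.
  - by apply: seg_integrableM (S _ gi) _ => x; exact: cvg_cst.
  - by apply: seg_integrableM (S _ fi) _ => x; exact: cvg_cst.
  rewrite !primZr; try exact: S.
  by rewrite -hst -Fst -Gst /D; ring.
have Dphi : prim a (fun x => `|f x| + `|g x|) t - prim a (fun x => `|f x| + `|g x|) s
   = prim s (fun x => `|f x| + `|g x|) t by apply: primB => //; exact: At.
rewrite Dphi; set phi := prim s (fun x => `|f x| + `|g x|) t.
have Hi : seg_integrable s t (fun x => f x * G t + g x * F s - h x).
  apply: seg_integrableB; last exact: S.
  by apply: seg_integrableD; apply: seg_integrableM (S _ _) _ => // x; exact: cvg_cst.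
apply: le_trans (ler_norm_prim Hi) _.
have -> : phi ^+ 2 = prim s (fun x => (`|f x| + `|g x|) * phi) t.
  by rewrite primZr ?expr2//; exact: S.
apply: le_prim; [exact: seg_integrable_norm| |].
  by apply: seg_integrableM (S _ phii) _ => x; exact: cvg_cst.
move=> x /andP[sx xt]; rewrite /h.
have -> : f x * G t + g x * F s - (f x * G x + g x * F x) =
   f x * (G t - G x) + g x * (F s - F x) by ring.
rewrite mulrDl; apply: le_trans (ler_normD _ _) _.
have ax : a <= x by exact: le_trans as_ sx.
have xb : x <= b by exact: le_trans xt tb.
rewrite !normrM lerD// ler_wpM2l//.
  rewrite (primB ax xt (At _ gi)).
  apply: le_trans (ler_norm_prim _) _; first exact: seg_integrableS gi.
  apply: le_trans (le_prim_seg sx xt (seg_integrable_norm (S _ gi)) _) _ => //.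
  apply: le_prim; [exact/seg_integrable_norm/S|exact: S|].
  by move=> y _; rewrite lerDr.
rewrite distrC (primB as_ sx (seg_integrableS _ _ fi))//.
apply: le_trans (ler_norm_prim _) _; first exact: seg_integrableS fi.
have fgi := S _ phii.
apply: (@le_trans _ _ (prim s (fun x => `|f x| + `|g x|) x)).
  apply: le_prim; [apply: seg_integrable_norm| |]; try exact: seg_integrableS phii.
    exact: seg_integrableS fi.
  by move=> y _; rewrite lerDl.
by rewrite -subr_ge0 (primB sx xt fgi) prim_ge0.
Qed.

(** * Derivatives and Gronwall's inequality *)

Lemma is_derive_mul (R : realType) (f g : R -> R) (x df dg : R) :
  is_derive x 1 f df -> is_derive x 1 g dg ->
  is_derive x 1 (fun t => f t * g t) (df * g x + f x * dg).
Proof.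
move=> fd gd; have := is_deriveM fd gd; rewrite /GRing.scale /= => fgd.
by apply: is_derive_eq fgd _; rewrite addrC mulrC.
Qed.

Lemma is_derive_affine (R : realType) (f : R -> R) (x k l d : R) :
  is_derive (k * x + l) 1 f d -> is_derive x 1 (fun t => f (k * t + l)) (k * d).
Proof.
move=> fd; have ad : is_derive x 1 (fun t : R => k * t + l) k.
  have := is_deriveD (is_deriveZ k (is_derive_id x (1 : R))) (is_derive_cst l x 1).
  by rewrite addr0 /GRing.scale /= mulr1.
by have := @is_derive1_comp _ f (fun t => k * t + l) x _ _ fd ad; rewrite mulrC.
Qed.

Lemma is_derive_continuous (R : realType) (f : R -> R) (x d : R) :
  is_derive x 1 f d -> {for x, continuous f}.
Proof. by case=> fd _; exact/differentiable_continuous/derivable1_diffP. Qed.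

Lemma is_derive_prim (R : realType) (a b x : R) (f : R -> R) :
  {within `[a, b], continuous f} -> a < x < b ->
  is_derive x 1 (prim a f) (f x).
Proof.
move=> cf /andP[ax xb].
have xab : x \in `]a, b[%R by rewrite in_itv /= ax xb.
have fx := within_continuous_continuous (lt_trans ax xb) cf xab.
have [d e] := continuous_FTC1_closed xb (seg_integrable_within cf) ax fx.
by apply: DeriveDef; [exact: d|rewrite -derive1E; exact: e].
Qed.

Lemma is_derive_nincr (R : realType) (f df : R -> R) (a b : R) :
  a <= b -> {within `[a, b], continuous f} ->
  (forall x, a < x < b -> is_derive x 1 f (df x)) ->
  (forall x, a < x < b -> df x <= 0) -> f b <= f a.
Proof.
move=> ab cf fd df0; apply: (@ler0_derive1_nincr _ f a b) => //.
- by move=> x; rewrite in_itv /= => /fd[].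
- move=> x; rewrite in_itv /= => xab; rewrite derive1E.
  by have := fd x xab => fdx; rewrite derive_val df0.
Qed.

(** [exp(-L t) \int_a^t h] is nonnegative, starts at 0 and has derivative
    [exp(-L t) (h t - L \int_a^t h) <= 0]. The [+ 0] in the exponent gives it the shape required by
    [is_derive_affine]. *)
Lemma gronwall0 (R : realType) (a b L : R) (h : R -> R) :
  a <= b -> {within `[a, b], continuous h} ->
  (forall t, a <= t <= b -> 0 <= h t <= L * prim a h t) -> h b = 0.
Proof.
move=> ab ch hL.
have h0 t : a <= t <= b -> 0 <= h t by move=> /hL/andP[].
have hi := seg_integrable_within ch.
have J0 : 0 <= prim a h b by apply: prim_ge0.
pose q t := expR (- L * t + 0) * prim a h t.
have eqd (t : R) : is_derive t 1 (fun t => expR (- L * t + 0))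
    (- L * expR (- L * t + 0)).
  by apply: is_derive_affine; exact: is_derive_expR.
have : q b <= q a.
  apply: (is_derive_nincr (df := fun t => - L * expR (- L * t + 0) * prim a h t
    + expR (- L * t + 0) * h t) ab).
  - move=> x; apply: cvgM; last exact: (prim_continuous ab hi).
    apply: continuous_subspaceT => y.
    exact: is_derive_continuous (eqd y).
  - by move=> x xab; apply: is_derive_mul (eqd x) (is_derive_prim ch xab).
  - move=> x /andP[ax xb]; rewrite mulrAC [X in _ + X]mulrC -mulrDl pmulr_lle0 ?expR_gt0//.
    have /andP[_] : 0 <= h x <= L * prim a h x by apply: hL; rewrite (ltW ax) (ltW xb).
    by rewrite mulNr addrC subr_le0.
rewrite /q prim_refl mulr0 pmulr_rle0 ?expR_gt0// => J1.
have Jb : prim a h b = 0 by apply/le_anti; rewrite J1.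
apply/le_anti; rewrite h0 ?ab ?lexx// andbT.
have /andP[_] : 0 <= h b <= L * prim a h b by apply: hL; rewrite ab lexx.
by rewrite Jb mulr0.
Qed.

(** * The string *)

(** [ramp 0] is the constant 1, not a step, and [ramp 1] has a corner at 0: hence the offsets [n.+1]
    in [rampE] and [n.+2] in [is_derive_ramp]. *)
Definition ramp (R : realType) (n : nat) (s : R) : R := Num.max 0 s ^+ n.

Lemma continuous_pos (R : realType) : continuous (fun s : R => Num.max 0 s).
Proof.
move=> x.
have E (s : R) : Num.max 0 s = (s + `|s|) / 2.
  by have [h|h] := leP 0 s; [rewrite ger0_norm|rewrite ltr0_norm]; lra.
under [X in continuous_at _ X]eq_fun do rewrite E.
by apply: cvgMl; apply: cvgD; [exact: cvg_id|exact: norm_continuous].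
Qed.

Lemma continuous_ramp (R : realType) (n : nat) : continuous (@ramp R n).
Proof.
elim: n => [|n IHn] x.
  under [X in continuous_at _ X]eq_fun do rewrite /ramp expr0.
  exact: cvg_cst.
under [X in continuous_at _ X]eq_fun do rewrite /ramp exprS.
by apply: cvgM; [exact: continuous_pos|exact: IHn].
Qed.

Lemma is_derive_cvg (R : realType) (f : R -> R) (x d : R) :
  h^-1 * (f (h + x) - f x) @[h --> 0^'] --> d -> is_derive x 1 f d.
Proof.
move=> fd.
have E : (fun h => h^-1 *: ((f \o shift x) (h *: (1 : R)) - f x)) =
         (fun h => h^-1 * (f (h + x) - f x)).
  by apply/funext => h; rewrite /GRing.scale /= mulr1.
apply: DeriveDef; first by rewrite /derivable E; apply/cvg_ex; exists d.
by rewrite /derive E; apply/cvg_lim.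
Qed.

Lemma rampE (R : realType) (n : nat) (s : R) :
  ramp n.+1 s = if 0 <= s then s ^+ n.+1 else 0.
Proof. by rewrite /ramp; have [h|h] := leP 0 s; rewrite // expr0n. Qed.

Lemma is_derive_expn (R : realType) (n : nat) (s : R) :
  is_derive s 1 (fun x => x ^+ n.+1) (n.+1%:R * s ^+ n).
Proof.
elim: n => [|n IHn].
  by rewrite expr0 mulr1; exact: is_derive_id.
have := is_derive_mul (is_derive_id s (1 : R)) IHn.
rewrite mulrCA -exprS mul1r -[X in X + _]mul1r -mulrDl nat1r.
rewrite (_ : (fun t => id t * _) = (fun t => t ^+ n.+2))//.
Qed.

Lemma is_derive_ramp (R : realType) (n : nat) (s : R) :
  is_derive s 1 (@ramp R n.+2) (n.+2%:R * ramp n.+1 s).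
Proof.
have [s0|s0|->] := ltgtP s 0.
- rewrite [ramp _ _]rampE leNgt s0 mulr0.
  apply: (@near_eq_is_derive R R R (cst 0)).
  
  near=> x; rewrite rampE leNgt ifF//=; apply/negbF.
  by near: x; exact: lt_nbhsl.
- rewrite [ramp _ _]rampE (ltW s0).
  apply: (@near_eq_is_derive R R R (fun x => x ^+ n.+2)).
    near=> x; rewrite rampE ifT//; apply/ltW.
    by near: x; exact: lt_nbhsr.
  exact: is_derive_expn.
- apply: is_derive_cvg.
  have -> : n.+2%:R * ramp n.+1 0 = ramp n.+1 0 :> R.
    by rewrite rampE lexx expr0n /= mulr0.
  apply: (@cvg_trans _ (@ramp R n.+1 @ 0^')); last first.
    by apply/continuous_withinNx; exact: continuous_ramp.
  apply: near_eq_cvg; near=> h.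
  have h0 : h != 0 by near: h; exact: nbhs_dnbhs_neq.
  rewrite addr0 !rampE lexx expr0n subr0; case: ifPn => _; last by rewrite mulr0.
  by rewrite [h ^+ n.+2]exprS mulKf.
Unshelve. all: by end_near. Qed.

(** D'Alembert's solution in the reversed time [S - t], so that a ramp profile vanishes for large
    [t]. The weights [k1], [k2] make derivatives again of this form. *)
Definition wave (R : realType) (c S : R) (p : R -> R) (k1 k2 : R) (x t : R) : R :=
  k1 * p (S - t - x / c) + k2 * p (S - t + x / c).

Lemma is_derive_add (R : realType) (f g : R -> R) (x df dg : R) :
  is_derive x 1 f df -> is_derive x 1 g dg ->
  is_derive x 1 (fun t => f t + g t) (df + dg).
Proof. exact: is_deriveD. Qed.

Lemma is_derive_scale (R : realType) (f : R -> R) (x k d : R) :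
  is_derive x 1 f d -> is_derive x 1 (fun t => k * f t) (k * d).
Proof. exact: is_deriveZ. Qed.

Lemma is_derive_wave_x (R : realType) (c S : R) (p q : R -> R) (k1 k2 : R) :
  (forall s : R, is_derive s 1 p (q s)) -> forall x t : R,
  is_derive x 1 (wave c S p k1 k2 ^~ t) (wave c S q (- k1 / c) (k2 / c) x t).
Proof.
move=> pq x t.
have E1 y : S - t - y / c = - c^-1 * y + (S - t) by ring.
have E2 y : S - t + y / c = c^-1 * y + (S - t) by ring.
rewrite (_ : wave _ _ _ _ _ ^~ t = fun y => k1 * p (- c^-1 * y + (S - t)) +
    k2 * p (c^-1 * y + (S - t))); last first.
  by apply/funext => y; rewrite /wave E1 E2.
have -> : wave c S q (- k1 / c) (k2 / c) x t =
    k1 * (- c^-1 * q (- c^-1 * x + (S - t))) +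
    k2 * (c^-1 * q (c^-1 * x + (S - t))).
  by rewrite /wave E1 E2; ring.
by apply: is_derive_add; apply: is_derive_scale; apply: is_derive_affine.
Qed.

Lemma is_derive_wave_t (R : realType) (c S : R) (p q : R -> R) (k1 k2 : R) :
  (forall s : R, is_derive s 1 p (q s)) -> forall x t : R,
  is_derive t 1 (wave c S p k1 k2 x) (wave c S q (- k1) (- k2) x t).
Proof.
move=> pq x t.
have E1 y : S - y - x / c = - 1 * y + (S - x / c) by ring.
have E2 y : S - y + x / c = - 1 * y + (S + x / c) by ring.
rewrite (_ : wave _ _ _ _ _ x = fun y => k1 * p (- 1 * y + (S - x / c)) +
    k2 * p (- 1 * y + (S + x / c))); last first.
  by apply/funext => y; rewrite /wave E1 E2.
have -> : wave c S q (- k1) (- k2) x t =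
    k1 * (- 1 * q (- 1 * t + (S - x / c))) +
    k2 * (- 1 * q (- 1 * t + (S + x / c))).
  by rewrite /wave E1 E2; ring.
by apply: is_derive_add; apply: is_derive_scale; apply: is_derive_affine.
Qed.

Lemma dx_wave (R : realType) (c S : R) (p q : R -> R) (k1 k2 : R) :
  (forall s : R, is_derive s 1 p (q s)) ->
  dx (wave c S p k1 k2) = wave c S q (- k1 / c) (k2 / c).
Proof.
move=> pq; apply/funext => x; apply/funext => t; rewrite /dx derive1E.
by have := is_derive_wave_x c S k1 k2 pq x t => d; rewrite derive_val.
Qed.

Lemma dt_wave (R : realType) (c S : R) (p q : R -> R) (k1 k2 : R) :
  (forall s : R, is_derive s 1 p (q s)) ->
  dt (wave c S p k1 k2) = wave c S q (- k1) (- k2).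
Proof.
move=> pq; apply/funext => x; apply/funext => t; rewrite /dt derive1E.
by have := is_derive_wave_t c S k1 k2 pq x t => d; rewrite derive_val.
Qed.

Lemma wave_C0 (R : realType) (c S : R) (p : R -> R) (k1 k2 : R) :
  continuous p -> C0_2d (wave c S p k1 k2).
Proof.
move=> cp z; rewrite /wave.
have cS (f : R * R -> R) k : continuous f -> {for z, continuous (fun z => k * p (f z))}.
  move=> cf; apply: cvgM; first exact: cvg_cst.
  by apply: (@continuous_comp _ _ _ f p); [exact: cf|exact: cp].
have c1 : continuous (fun z : R * R => S - z.2).
  by move=> y; apply: cvgB; [exact: cvg_cst|exact: cvg_snd].
have c2 : continuous (fun z : R * R => z.1 / c).
  by move=> y; apply: cvgMl; exact: cvg_fst.
apply: cvgD; apply: cS => y.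
  by apply: cvgB; [exact: c1|exact: c2].
by apply: cvgD; [exact: c1|exact: c2].
Qed.

Lemma wave_C1 (R : realType) (c S : R) (p q : R -> R) (k1 k2 : R) :
  (forall s : R, is_derive s 1 p (q s)) -> continuous q ->
  C1_2d (wave c S p k1 k2).
Proof.
move=> pq cq; split.
- by apply: wave_C0 => s; exact: is_derive_continuous (pq s).
- by move=> x t; case: (is_derive_wave_x c S k1 k2 pq x t).
- by move=> x t; case: (is_derive_wave_t c S k1 k2 pq x t).
- by rewrite (dx_wave c S k1 k2 pq); exact: wave_C0.
- by rewrite (dt_wave c S k1 k2 pq); exact: wave_C0.
Qed.

(** Weights 1 and -1 cancel at [x = 0], and both ramps are zero once [t >= S + 1/c]. The cube is the
    lowest power of the ramp that is twice continuously differentiable. *)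
Lemma wave_test_function (R : realType) (c S : R) : 0 < c ->
  test_function (wave c S (@ramp R 3) 1 (-1)).
Proof.
move=> c0.
have d3 (s : R) : is_derive s 1 (@ramp R 3) (3 * ramp 2 s) by exact: is_derive_ramp.
have d2 (s : R) : is_derive s 1 (fun s => 3 * @ramp R 2 s) (3 * (2 * ramp 1 s)).
  by apply: is_derive_scale; exact: is_derive_ramp.
have c2 : continuous (fun s => 3 * @ramp R 2 s).
  by move=> s; apply: is_derive_continuous (d2 s).
have c1 : continuous (fun s => 3 * (2 * @ramp R 1 s)).
  by move=> s; do 2 (apply: cvgM; first exact: cvg_cst); exact: continuous_ramp.
split.
- split; first exact: wave_C1 d3 c2.
  + by rewrite (dx_wave c S _ _ d3); exact: wave_C1 d2 c1.
  + by rewrite (dt_wave c S _ _ d3); exact: wave_C1 d2 c1.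
- by move=> t _; rewrite /wave mul0r subr0 addr0; ring.
exists (S + c^-1) => x t /andP[x0 x1] St.
have h1 : x / c <= c^-1 by rewrite ler_piMl// invr_ge0 ltW.
have h2 : 0 <= x / c by rewrite divr_ge0// ltW.
rewrite /wave /ramp !max_l ?expr0n ?mulr0 ?addr0//; lra.
Qed.

(* Its third derivative in [S] is [2 f S]; it arises from the cubic ramp in the
   test function. *)
Definition moment2 (R : realType) (a : R) (f : R -> R) (S : R) : R :=
  prim a (fun t => f t * (S - t) ^+ 2) S.

Lemma ramp_patch (R : realType) (a S : R) (f : R -> R) : a <= 0 ->
  (forall t, t <= 0 -> f t = 0) ->
  (fun t => f t * ramp 2 (S - t)) \_ `[0, +oo[ =
  (fun t => f t * (S - t) ^+ 2) \_ `[a, S].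
Proof.
move=> a0 f0; apply/funext => t; rewrite !patchE !mem_setE /= !in_itv /= andbT.
have [t0|t0] := leP 0 t; last by rewrite f0 ?(ltW t0)// mul0r if_same.
by rewrite (le_trans a0 t0) rampE subr_ge0 /=; case: ifP => // _; rewrite mulr0.
Qed.

Lemma Rintegral_ramp (R : realType) (a S : R) (f : R -> R) : a <= 0 ->
  (forall t, t <= 0 -> f t = 0) ->
  \int[@lebesgue_measure R]_(t in `[0, +oo[) (f t * ramp 2 (S - t)) =
  moment2 a f S.
Proof.
by move=> a0 f0; rewrite /moment2 /prim [LHS]Rintegral_mkcond (ramp_patch _ a0 f0)
  [RHS]Rintegral_mkcond.
Qed.

Lemma continuous_moment (R : realType) (S : R) (n : nat) (f : R -> R) :
  continuous f -> continuous (fun t => f t * (S - t) ^+ n).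
Proof.
move=> cf x; apply: cvgM; first exact: cf.
apply: (@continuous_comp _ _ _ (fun t => S - t) (fun t => t ^+ n)).
  by apply: cvgB; [exact: cvg_cst|exact: cvg_id].
exact: exprn_continuous.
Qed.

Lemma integrable_ramp (R : realType) (S : R) (f : R -> R) : continuous f ->
  (forall t, t <= 0 -> f t = 0) ->
  (@lebesgue_measure R).-integrable `[0, +oo[
    (EFin \o (fun t => f t * ramp 2 (S - t))).
Proof.
move=> cf f0; apply/(integrable_mkcond _ _).2 => //.
rewrite restrict_EFin (ramp_patch S (lexx 0) f0) -restrict_EFin.
apply/(integrable_mkcond _ _).1 => //.
apply: seg_integrable_within.
exact/continuous_subspaceT/continuous_moment.
Qed.

Lemma integrable_rampZ (R : realType) (S k : R) (f : R -> R) : continuous f ->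
  (forall t, t <= 0 -> f t = 0) ->
  (@lebesgue_measure R).-integrable `[0, +oo[
    (EFin \o (fun t => k * (f t * ramp 2 (S - t)))).
Proof.
move=> cf f0; under [X in _ \o X]eq_fun do rewrite mulrA.
apply: integrable_ramp => [x|t t0]; last by rewrite f0 ?mulr0.
by apply: cvgM; [exact: cvg_cst|exact: cf].
Qed.

(** The test wave kills the double integral and the initial data are zero, so only the traces
    remain. The coefficients on the left are, up to a common factor, those of [phi_x - c0 phi_t] at
    [x = 1] for the two directions of travel; their quotient is [alpha]. *)
Lemma weak_moment (R : realType) (c c0 a : R) (u : R -> R -> R) (w y : R -> R) :
  0 < c -> a <= 0 -> weak_damped_string c c0 (fun=> 0) (fun=> 0) u ->
  continuous w -> continuous y ->
  (forall t, t <= 0 -> w t = 0) -> (forall t, t <= 0 -> y t = 0) ->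
  (forall t, 0 <= t -> u 1 t = w t) -> (forall t, 0 <= t -> u 0 t = y t) ->
  forall S, (c^-1 - c0) * moment2 a w (S - c^-1) + (c^-1 + c0) * moment2 a w (S + c^-1)
    = 2 / c * moment2 a y S.
Proof.
move=> cgt0 a0 weak cw cy w0 y0 uw uy S.
have := weak _ (wave_test_function S cgt0).
have d3 (s : R) : is_derive s 1 (@ramp R 3) (3 * ramp 2 s) by exact: is_derive_ramp.
have d2 (s : R) : is_derive s 1 (fun s => 3 * @ramp R 2 s) (3 * (2 * ramp 1 s)).
  by apply: is_derive_scale; exact: is_derive_ramp.
rewrite (dt_wave c S 1 (-1) d3) (dx_wave c S 1 (-1) d3).
rewrite (dt_wave c S _ _ d2) (dx_wave c S _ _ d2).
have cn0 : c != 0 by rewrite gt_eqF.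
under eq_Rintegral => t _.
  under eq_Rintegral => x _.
    have -> : u x t * (wave c S (fun s => 3 * (2 * ramp 1 s)) (- - 1) (- - -1) x t -
        c ^+ 2 * wave c S (fun s => 3 * (2 * ramp 1 s)) (- (-1 / c) / c) ((-1 / c) / c) x t)
        = 0 by rewrite /wave; field.
    over.
  rewrite Rintegral_cst// mul0r; over.
rewrite Rintegral_cst// mul0r add0r.
under [X in _ + X - _]eq_Rintegral => t _ do rewrite !mul0r subr0.
rewrite Rintegral_cst// mul0r !mul0r mulr0 subr0 addr0.
have -> : \int[@lebesgue_measure R]_(t in `[0, +oo[)
    (u 1 t * (wave c S (fun s => 3 * ramp 2 s) (-1 / c) (-1 / c) 1 t -
      c0 * wave c S (fun s => 3 * ramp 2 s) (- 1) (- -1) 1 t)) =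
    -3 * (c^-1 - c0) * moment2 a w (S - c^-1) - 3 * (c^-1 + c0) * moment2 a w (S + c^-1).
  transitivity (\int[@lebesgue_measure R]_(t in `[0, +oo[)
     (-3 * (c^-1 - c0) * (w t * ramp 2 (S - c^-1 - t)) -
      3 * (c^-1 + c0) * (w t * ramp 2 (S + c^-1 - t)))).
    apply: eq_Rintegral => t; rewrite inE /= in_itv /= andbT => t0; rewrite uw// /wave.
    rewrite !div1r (_ : S - t - c^-1 = S - c^-1 - t); last by ring.
    by rewrite (_ : S - t + c^-1 = S + c^-1 - t); last ring; field.
  rewrite RintegralB//.
  - rewrite !RintegralZl//; try exact: integrable_ramp.
    by rewrite !(Rintegral_ramp _ a0 w0).
  - exact: integrable_rampZ.
  - exact: integrable_rampZ.
have -> : \int[@lebesgue_measure R]_(t in `[0, +oo[)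
    (u 0 t * wave c S (fun s => 3 * ramp 2 s) (-1 / c) (-1 / c) 0 t) =
    -6 / c * moment2 a y S.
  transitivity (\int[@lebesgue_measure R]_(t in `[0, +oo[)
     (-6 / c * (y t * ramp 2 (S - t)))).
    apply: eq_Rintegral => t; rewrite inE /= in_itv /= andbT => t0; rewrite uy// /wave.
    by rewrite mul0r subr0 addr0; field.
  by rewrite RintegralZl ?(Rintegral_ramp _ a0 y0)//; exact: integrable_ramp.
set P := moment2 _ _ _; set Q := moment2 _ _ _; set Z := moment2 _ _ _.
have c2 : c ^+ 2 != 0 by rewrite expf_neq0.
move=> H; apply: (mulfI c2); nra.
Qed.

Definition moment1 (R : realType) (a : R) (f : R -> R) (S : R) : R :=
  prim a (fun t => f t * (S - t)) S.

Lemma seg_integrable_continuous (R : realType) (a b : R) (f : R -> R) :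
  continuous f -> seg_integrable a b f.
Proof. by move=> cf; exact/seg_integrable_within/continuous_subspaceT. Qed.

Lemma is_derive_prim_cont (R : realType) (a x : R) (f : R -> R) :
  continuous f -> a < x -> is_derive x 1 (prim a f) (f x).
Proof.
move=> cf ax; have axx : a < x < x + 1 by rewrite ax ltrDl ltr01.
have cw : {within `[a, x + 1], continuous f} by exact: continuous_subspaceT.
exact: is_derive_prim cw axx.
Qed.

Lemma is_derive_moment1 (R : realType) (a S : R) (f : R -> R) :
  continuous f -> a < S -> is_derive S 1 (moment1 a f) (prim a f S).
Proof.
move=> cf aS.
have cf1 : continuous (fun t => f t * t).
  by move=> t; apply: cvgM; [exact: cf|exact: cvg_id].
rewrite (_ : moment1 a f = fun S => S * prim a f S + -1 * prim a (fun t => f t * t) S).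
  have := is_derive_add (is_derive_mul (is_derive_id S (1 : R)) (is_derive_prim_cont cf aS))
    (is_derive_scale (-1) (is_derive_prim_cont cf1 aS)).
  by move=> /is_derive_eq; apply; rewrite /=; ring.
apply/funext => s; rewrite -primZl; last exact: seg_integrable_continuous.
rewrite -primZl; last exact: seg_integrable_continuous.
rewrite -primD; first by apply: eq_prim => t _; ring.
- exact/seg_integrableZl/seg_integrable_continuous.
- exact/seg_integrableZl/seg_integrable_continuous.
Qed.

Lemma is_derive_moment2 (R : realType) (a S : R) (f : R -> R) :
  continuous f -> a < S -> is_derive S 1 (moment2 a f) (2 * moment1 a f S).
Proof.
move=> cf aS.
have cf1 : continuous (fun t => f t * t).
  by move=> t; apply: cvgM; [exact: cf|exact: cvg_id].
have E s : moment2 a f s = s * moment1 a f s + -1 * moment1 a (fun t => f t * t) s.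
  have c1 (g : R -> R) : continuous g -> seg_integrable a s (fun t => g t * (s - t)).
    by move=> cg; apply: seg_integrable_continuous; exact: (continuous_moment (n := 1)).
  rewrite -primZl; last exact: c1.
  rewrite -primZl; last exact: c1.
  rewrite -primD; first by apply: eq_prim => t _; ring.
  - exact/seg_integrableZl/c1.
  - exact/seg_integrableZl/c1.
rewrite (_ : moment2 a f = fun s => s * moment1 a f s +
  -1 * moment1 a (fun t => f t * t) s); last exact/funext.
have := is_derive_add (is_derive_mul (is_derive_id S (1 : R)) (is_derive_moment1 cf aS))
    (is_derive_scale (-1) (is_derive_moment1 cf1 aS)).
move=> /is_derive_eq; apply; rewrite /=.
rewrite mulN1r mul1r -addrA.
suff -> : S * prim a f S - prim a (fun t => f t * t) S = moment1 a f S by ring.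
rewrite /moment1 -primZl; last exact: seg_integrable_continuous.
rewrite -prim_sub; first by apply: eq_prim => t _; ring.
- exact/seg_integrableZl/seg_integrable_continuous.
- exact: seg_integrable_continuous.
Qed.

Lemma is_derive_translate (R : realType) (f : R -> R) (x e d : R) :
  is_derive (x + e) 1 f d -> is_derive x 1 (fun t => f (t + e)) d.
Proof.
move=> fd; have := @is_derive_affine _ f x 1 e d; rewrite !mul1r => /(_ fd).
rewrite (_ : (fun t => f (1 * t + e)) = (fun t => f (t + e)))//.
by apply/funext => t; rewrite mul1r.
Qed.

(** The relation holds on an open half-line, so it may be differentiated; there [s - d] stays above
    [a], where [w] is differentiable. *)
Lemma is_derive_shift_eq (R : realType) (a d A B C : R) (w y w' y' : R -> R) :
  0 <= d ->
  (forall s, a < s -> is_derive s 1 w (w' s)) ->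
  (forall s, a < s -> is_derive s 1 y (y' s)) ->
  (forall s, a + d < s -> A * w (s - d) + B * w (s + d) = C * y s) ->
  forall s, a + d < s -> A * w' (s - d) + B * w' (s + d) = C * y' s.
Proof.
move=> d0 dw dy E s ads.
have d1 : is_derive s 1 (fun s => A * w (s - d) + B * w (s + d))
    (A * w' (s - d) + B * w' (s + d)).
  apply: is_derive_add; apply: is_derive_scale; apply: is_derive_translate;
    by apply: dw; lra.
have d2 : is_derive s 1 (fun s => C * y s) (C * y' s).
  by apply: is_derive_scale; apply: dy; lra.
have d3 : is_derive s 1 (fun s => C * y s) (A * w' (s - d) + B * w' (s + d)).
  apply: near_eq_is_derive d1; near=> x; apply: E.
  by near: x; exact: lt_nbhsr.
have := @derive_val _ _ _ _ _ _ _ d3.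
by have := @derive_val _ _ _ _ _ _ _ d2 => -> ->.
Unshelve. all: by end_near. Qed.

(** Three differentiations in [S] remove the quadratic kernel, passing through [moment2], [moment1]
    and [prim] down to the traces, which are merely continuous. *)
Lemma weak_reflection (R : realType) (c c0 : R) (u : R -> R -> R) (w y : R -> R) :
  0 < c -> weak_damped_string c c0 (fun=> 0) (fun=> 0) u ->
  continuous w -> continuous y ->
  (forall t, t <= 0 -> w t = 0) -> (forall t, t <= 0 -> y t = 0) ->
  (forall t, 0 <= t -> u 1 t = w t) -> (forall t, 0 <= t -> u 0 t = y t) ->
  forall t, (c^-1 - c0) * w (t - c^-1) + (c^-1 + c0) * w (t + c^-1) = 2 / c * y t.
Proof.
move=> cgt0 weak cw cy w0 y0 uw uy t.
have d0 : 0 <= c^-1 by rewrite invr_ge0 ltW.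
(* [a <= 0] for the moments to agree with integrals over [[0, +oo[], and [a < t - 1/c] so that all
   derivatives are taken above the base point. *)
pose a := Num.min 0 (t - c^-1 - 1).
have a0 : a <= 0 by rewrite ge_min lexx.
have at_ : a + c^-1 < t.
  by rewrite -ltrBrDr (@le_lt_trans _ _ (t - c^-1 - 1)) ?ge_min ?lexx ?orbT// gtrBl.
have E2 := weak_moment cgt0 a0 weak cw cy w0 y0 uw uy.
have E1 : forall s, a + c^-1 < s ->
    (c^-1 - c0) * moment1 a w (s - c^-1) + (c^-1 + c0) * moment1 a w (s + c^-1) =
    2 / c * moment1 a y s.
  move=> s ads.
  have := is_derive_shift_eq d0 (fun s => @is_derive_moment2 _ a s w cw)
    (fun s => @is_derive_moment2 _ a s y cy) (fun s _ => E2 s) ads.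
  lra.
have E0 := is_derive_shift_eq d0 (fun s => @is_derive_moment1 _ a s w cw)
    (fun s => @is_derive_moment1 _ a s y cy) E1.
exact: (is_derive_shift_eq d0 (fun s => @is_derive_prim_cont _ a s w cw)
    (fun s => @is_derive_prim_cont _ a s y cy) E0).
Qed.

(** * Energy estimates *)

Lemma bounded_energy_prim (R : realType) (r : R -> R) : bounded_energy r ->
  exists E, forall T, 0 <= T -> [/\ seg_integrable 0 T r,
    seg_integrable 0 T (fun t => r t ^+ 2) & prim 0 (fun t => r t ^+ 2) T <= E].
Proof.
move=> [mr ir].
have mr2 : measurable_fun (`[0, +oo[ : set R) (fun t => r t ^+ 2).
  exact: measurable_funX.
have ir2 : (@lebesgue_measure R).-integrable `[0, +oo[ (EFin \o (fun t => r t ^+ 2)).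
  apply/integrableP; split; first exact/measurable_EFinP.
  by under eq_integral => t _ do rewrite /= ger0_norm ?sqr_ge0//.
exists (\int[@lebesgue_measure R]_(t in `[0, +oo[) (r t ^+ 2)) => T T0.
have sub : (`[0, T] : set R) `<=` `[0, +oo[.
  by move=> t /=; rewrite !in_itv /= andbT => /andP[].
have ir2T : seg_integrable 0 T (fun t => r t ^+ 2) by exact: integrableS ir2.
have mrT : measurable_fun (`[0, T] : set R) r by exact: measurable_funS mr.
split => //.
(* Domination [|r| <= 1 + r^2]. *)
- have := seg_integrableD (seg_integrable_cst 0 T 1) ir2T.
  apply: le_integrable => //; first exact/measurable_EFinP.
  move=> t _; rewrite /= lee_fin [leRHS]ger0_norm ?addr_ge0 ?sqr_ge0//.
  have := sqr_ge0 (`|r t| - 1); rewrite -[r t ^+ 2]real_normK ?num_real//.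
  have := normr_ge0 (r t); nra.
- apply: fine_le.
  + exact: integrable_fin_num ir2T.
  + exact: integrable_fin_num ir2.
  + apply: ge0_subset_integral => //; first exact/measurable_EFinP.
    by move=> t _; rewrite lee_fin sqr_ge0.
Qed.

Lemma prim_bounded_energy (R : realType) (y : R -> R) (C : R) :
  {within `[0, +oo[, continuous y} ->
  (forall T, 0 <= T -> prim 0 (fun t => y t ^+ 2) T <= C) -> bounded_energy y.
Proof.
move=> cy yC.
have my : measurable_fun (`[0, +oo[ : set R) y.
  exact: subspace_continuous_measurable_fun.
split => //.
have my2 : measurable_fun (`[0, +oo[ : set R) (fun t => (y t ^+ 2)%:E).
  exact/measurable_EFinP/measurable_funX.
pose F (k : nat) : set R := `[0, 0 + k%:R]%classic.
have FE : `[0, +oo[%classic = \bigcup_k F k by rewrite itv_bndy_bigcup_BRight.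
have sub k : F k `<=` `[0, +oo[.
  by move=> t /=; rewrite !in_itv /= andbT => /andP[].
have : (\int[@lebesgue_measure R]_(t in F k) (y t ^+ 2)%:E @[k --> \oo] -->
    \int[@lebesgue_measure R]_(t in \bigcup_k F k) (y t ^+ 2)%:E)%E.
  apply: ge0_nondecreasing_set_cvg_integral => //.
  - move=> m k mk; rewrite subsetEset; apply: subset_itvl.
    by rewrite bnd_simp !add0r ler_nat.
  - by move=> k; exact: measurable_itv.
  - by move=> k; apply: measurable_funS my2 => //; exact: sub.
  - by move=> k t _; rewrite lee_fin sqr_ge0.
rewrite -FE => Fcvg; apply: (@le_lt_trans _ _ C%:E); last exact: ltry.
rewrite -(cvg_lim _ Fcvg)//; apply: lime_le; first by apply/cvg_ex; eexists; exact: Fcvg.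
near=> k.
have ik : seg_integrable 0 (0 + k%:R) (fun t => y t ^+ 2).
  apply: seg_integrable_within.
  apply: continuous_subspaceW (@sub k) _.
  under [X in {within _, continuous X}]eq_fun do rewrite expr2.
  by move=> t; apply: cvgM; exact: cy.
have := yC (0 + k%:R); rewrite add0r ler0n => /(_ isT).
rewrite -lee_fin /prim /Rintegral fineK; first by rewrite /F add0r.
by have := integrable_fin_num _ ik; rewrite add0r; apply.
Unshelve. all: by end_near. Qed.

(* [(a + b)^2 <= a^2 / (1 - th) + b^2 / th] with [th = |A| / B], cleared of
   denominators. *)
Lemma delay_square_le (R : realFieldType) (A B a w w' : R) : `|A| < B ->
  A * w' + B * w = a ->
  B * (B - `|A|) * w ^+ 2 <= a ^+ 2 + `|A| * (B - `|A|) * w' ^+ 2.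
Proof.
move=> AB E; have A0 := normr_ge0 A; have B0 : 0 < B by exact: le_lt_trans AB.
have aw : B * w = a - A * w' by rewrite -E; ring.
rewrite -(ler_pM2l B0) -subr_ge0.
have -> : B * (B * (B - `|A|) * w ^+ 2) = (B - `|A|) * (a - A * w') ^+ 2.
  by rewrite -aw; ring.
have [h|h] := leP 0 A; [rewrite ger0_norm//|rewrite ltr0_norm//].
  rewrite (_ : _ - _ = A * (a + (B - A) * w') ^+ 2); last by ring.
  by rewrite mulr_ge0// sqr_ge0.
rewrite (_ : _ - _ = - A * (a - (B + A) * w') ^+ 2); last by ring.
by rewrite mulr_ge0 ?oppr_ge0 ?(ltW h)// sqr_ge0.
Qed.

Lemma prim_from_neg (R : realType) (a T : R) (f : R -> R) :
  a <= 0 -> 0 <= T -> continuous f -> (forall t, t <= 0 -> f t = 0) ->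
  prim a f T = prim 0 f T.
Proof.
move=> a0 T0 cf f0.
rewrite -(primB a0 T0 (seg_integrable_continuous a T cf)).
rewrite [X in _ = _ - X](@eq_prim _ _ _ _ (fun=> 0)) => [|t /andP[_ /f0]//].
by rewrite [X in _ - X]Rintegral_cst// mul0r subr0.
Qed.

Lemma prim_ndecr (R : realType) (a s t : R) (f : R -> R) : a <= s -> s <= t ->
  continuous f -> (forall x, 0 <= f x) -> prim a f s <= prim a f t.
Proof.
move=> as_ st cf f0; rewrite -subr_ge0.
by rewrite (primB as_ st (seg_integrable_continuous a t cf)) prim_ge0.
Qed.

Lemma continuous_sqr (R : realType) (f : R -> R) :
  continuous f -> continuous (fun t => f t ^+ 2).
Proof.
move=> cf; under [X in continuous X]eq_fun do rewrite expr2.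
by move=> t; apply: cvgM; exact: cf.
Qed.

(** Integrate [delay_square_le]: the delayed energies, taken up to an earlier time, are at most the
    present ones, and that of [w] is absorbed thanks to [B (B - |A|) - |A| (B - |A|) = (B - |A|)^2].
    The integration is the monotonicity of [D], whose derivative is nonpositive by that
    inequality. *)
Lemma delay_gain (R : realType) (tau A B C : R) (w y : R -> R) :
  0 <= tau -> continuous w -> continuous y -> `|A| < B ->
  (forall t, t <= 0 -> w t = 0) -> (forall t, t <= 0 -> y t = 0) ->
  (forall t, A * w (t - tau) + B * w (t + tau) = C * y t) ->
  forall T, 0 <= T -> (B - `|A|) ^+ 2 * prim 0 (fun t => w t ^+ 2) T <=
    C ^+ 2 * prim 0 (fun t => y t ^+ 2) T.
Proof.
move=> tau0 cw cy AB w0 y0 E T T0.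
(* Below every [t - 2 tau] with [t >= 0], so that the shifted primitives are differentiable
   there. *)
pose a := - (2 * tau + 1); have a0 : a <= 0 by rewrite /a; lra.
have cw2 := continuous_sqr cw; have cy2 := continuous_sqr cy.
have [m0 m1] := (normr_ge0 A, AB).
set m := `|A| in m0 m1 *.
rewrite -!(prim_from_neg a0 T0)//; try by move=> t t0; rewrite ?w0 ?y0// expr0n.
set M := prim a (fun t => w t ^+ 2); set N := prim a (fun t => y t ^+ 2).
pose D t := B * (B - m) * M t - (C ^+ 2 * N (t + - tau) +
   m * (B - m) * M (t + - (2 * tau))).
pose D' t := B * (B - m) * w t ^+ 2 - (C ^+ 2 * y (t + - tau) ^+ 2 +
   m * (B - m) * w (t + - (2 * tau)) ^+ 2).
have dD (t : R) : 0 <= t -> is_derive t 1 D (D' t).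
  move=> t0; rewrite /D /D'.
  have dM (s : R) : a < s -> is_derive s 1 M (w s ^+ 2) by exact: is_derive_prim_cont.
  have dN (s : R) : a < s -> is_derive s 1 N (y s ^+ 2) by exact: is_derive_prim_cont.
  apply: is_deriveB.
    by apply: is_derive_scale; apply: dM; rewrite /a; lra.
  apply: is_derive_add; apply: is_derive_scale; apply: is_derive_translate.
    by apply: dN; rewrite /a; lra.
  by apply: dM; rewrite /a; lra.
have DT : D T <= D 0.
  apply: (is_derive_nincr (df := D') T0).
  - apply: continuous_in_subspaceT => t; rewrite inE /= in_itv /= => /andP[t0 _].
    exact: is_derive_continuous (dD t t0).
  - by move=> t /andP[/ltW t0 _]; exact: dD.
  - move=> t _; rewrite /D' subr_le0 -exprMn; apply: delay_square_le AB _.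
    have := E (t + - tau); rewrite (_ : t + - tau - tau = t + - (2 * tau)); last by ring.
    by rewrite subrK.
have Mge0 s : 0 <= M s by apply: prim_ge0 => x _; exact: sqr_ge0.
have Nge0 s : 0 <= N s by apply: prim_ge0 => x _; exact: sqr_ge0.
have M0 : M 0 = 0.
  rewrite /M (prim_from_neg a0 (lexx 0))// ?prim_refl// => t t0.
  by rewrite w0// expr0n.
have D0 : D 0 <= 0.
  rewrite /D M0 mulr0 sub0r oppr_le0 addr_ge0// mulr_ge0 ?sqr_ge0//.
  by rewrite mulr_ge0// subr_ge0 ltW.
have MT : M (T + - (2 * tau)) <= M T.
  by apply: prim_ndecr => // [||x]; rewrite ?sqr_ge0// /a; lra.
have NT : N (T + - tau) <= N T.
  by apply: prim_ndecr => // [||x]; rewrite ?sqr_ge0// /a; lra.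
have h1 : C ^+ 2 * N (T + - tau) <= C ^+ 2 * N T by rewrite ler_wpM2l ?sqr_ge0.
have h2 : m * (B - m) * M (T + - (2 * tau)) <= m * (B - m) * M T.
  by rewrite ler_wpM2l// mulr_ge0// subr_ge0 ltW.
have := le_trans DT D0; rewrite /D subr_le0 => h3.
rewrite (_ : _ * M T = B * (B - m) * M T - m * (B - m) * M T); last by ring.
lra.
Qed.

Lemma continuous_bigsum (R : realType) (I : Type) (s : seq I) (F : I -> R -> R) :
  (forall i, continuous (F i)) -> continuous (fun x => \sum_(i <- s) F i x).
Proof.
move=> cF; elim: s => [|i s IHs] x.
  by under [X in continuous_at _ X]eq_fun do rewrite big_nil; exact: cvg_cst.
under [X in continuous_at _ X]eq_fun do rewrite big_cons.
by apply: cvgD; [exact: cF|exact: IHs].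
Qed.

Lemma continuous_mulmx_col (R : realType) (m n : nat) (A : 'M[R]_(m, n))
    (X : R -> 'cV[R]_n) (i : 'I_m) :
  (forall j, continuous (fun t => X t j 0)) ->
  continuous (fun t => (A *m X t) i 0).
Proof.
move=> cX; under [X in continuous X]eq_fun do rewrite mxE.
by apply: continuous_bigsum => j t; apply: cvgM; [exact: cvg_cst|exact: cX].
Qed.

(** [N B = 0] removes the input and [N A = N A N] closes the equation on [N X], a linear one with
    zero initial value; Gronwall's inequality applies to the sum of the absolute values of its
    entries. *)
Lemma state_annihilated (R : realType) (n : nat) (A N : 'M[R]_n) (B : 'cV[R]_n)
    (X : R -> 'cV[R]_n) (v : R -> R) (T : R) :
  N *m B = 0 -> N *m A = N *m A *m N ->
  (forall j, continuous (fun t => X t j 0)) -> seg_integrable 0 T v ->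
  (forall t, 0 <= t <= T -> forall i,
    X t i 0 = prim 0 (fun s => (A *m X s + v s *: B) i 0) t) ->
  forall t, 0 <= t <= T -> N *m X t = 0.
Proof.
move=> NB NA cX vi XE t /andP[t0 tT].
pose f i s := (A *m X s + v s *: B) i 0.
have fi s i : s <= T -> seg_integrable 0 s (f i).
  move=> sT; rewrite /f; under [X in seg_integrable _ _ X]eq_fun do rewrite mxE.
  apply: seg_integrableD; first exact/seg_integrable_continuous/continuous_mulmx_col.
  under [X in seg_integrable _ _ X]eq_fun do rewrite mxE.
  apply: seg_integrableM; first exact: seg_integrableS vi.
  by move=> x; exact: cvg_cst.
pose h s := \sum_i `|(N *m X s) i 0|.
have ch : continuous h.
  apply: continuous_bigsum => i s; apply: cvg_norm.
  exact: continuous_mulmx_col.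
have cm M i : continuous (fun s => (M *m X s) i 0) by exact: continuous_mulmx_col.
pose L := \sum_i \sum_k `|(N *m A) i k|.
suff h0 : h t = 0.
  apply/colP => i; rewrite [RHS]mxE; apply/eqP; rewrite -normr_eq0.
  have /eqP := h0; rewrite psumr_eq0 => [/allP/(_ i)|j _]; last exact: normr_ge0.
  by rewrite mem_index_enum => /(_ isT).
apply: (@gronwall0 _ 0 t L) => //; first exact: continuous_subspaceT.
move=> s /andP[s0 st]; rewrite sumr_ge0//= /L mulr_suml.
have sT := le_trans st tT.
apply: ler_sum => i _.
have -> : (N *m X s) i 0 = prim 0 (fun x => (N *m A *m (N *m X x)) i 0) s.
  rewrite mxE; transitivity (\sum_j prim 0 (fun x => N i j * f j x) s).
    by apply: eq_bigr => j _; rewrite (XE s) ?s0// primZl//; exact: fi.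
  rewrite -prim_sum; last by move=> j; apply: seg_integrableZl; exact: fi.
  apply: eq_prim => x _; rewrite mulmxA -NA.
  transitivity ((N *m (A *m X x + v x *: B)) i 0); first by rewrite [RHS]mxE.
  by rewrite mulmxDr -scalemxAr NB scaler0 addr0 mulmxA.
have ci := seg_integrable_continuous 0 s ch.
apply: le_trans (ler_norm_prim _) _.
  under [X in seg_integrable _ _ X]eq_fun do rewrite mulmxA.
  exact: seg_integrable_continuous.
rewrite -primZl//; apply: le_prim.
- apply: seg_integrable_norm.
  under [X in seg_integrable _ _ X]eq_fun do rewrite mulmxA.
  exact: seg_integrable_continuous.
- exact: seg_integrableZl.
move=> x _; rewrite mxE; apply: le_trans (ler_norm_sum _ _ _) _.
rewrite mulr_suml; apply: ler_sum => k _; rewrite normrM ler_wpM2l//.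
by rewrite /h (bigD1 k)//= lerDl sumr_ge0.
Qed.

(** The storage [X^T P X] starts at 0 and is nonnegative at [T]. Being only absolutely continuous,
    it is expanded entrywise and each [X_i X_j] is written as an integral by [prim_product]. *)
Lemma state_dissipation (R : realType) (n : nat) (A P : 'M[R]_n)
    (B : 'cV[R]_n) (K : 'rV[R]_n) (g : R) (X : R -> 'cV[R]_n) (v : R -> R) (T : R) :
  P^T = P -> (forall x : 'cV_n, 0 <= (x^T *m P *m x) 0 0) ->
  0 <= T -> (forall j, continuous (fun t => X t j 0)) -> seg_integrable 0 T v ->
  seg_integrable 0 T (fun t => v t ^+ 2) ->
  (forall t, 0 <= t <= T ->
    ((X t)^T *m P *m (A *m X t + v t *: B)) 0 0 <= g ^+ 2 * v t ^+ 2 - (K *m X t) 0 0 ^+ 2) ->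
  (forall t, 0 <= t <= T -> forall i,
    X t i 0 = prim 0 (fun s => (A *m X s + v s *: B) i 0) t) ->
  prim 0 (fun t => (K *m X t) 0 0 ^+ 2) T <= g ^+ 2 * prim 0 (fun t => v t ^+ 2) T.
Proof.
move=> PT P0 T0 cX vi v2i PK XE.
pose f i s := (A *m X s + v s *: B) i 0.
have fi i : seg_integrable 0 T (f i).
  rewrite /f; under [X in seg_integrable _ _ X]eq_fun do rewrite mxE.
  apply: seg_integrableD; first exact/seg_integrable_continuous/continuous_mulmx_col.
  under [X in seg_integrable _ _ X]eq_fun do rewrite mxE.
  by apply: seg_integrableM => // x; exact: cvg_cst.
have fXi i j : seg_integrable 0 T (fun s => f i s * X s j 0 + f j s * X s i 0).
  by apply: seg_integrableD; apply: seg_integrableM => //; exact: continuous_subspaceT.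
have prodE i j : X T i 0 * X T j 0 =
    prim 0 (fun s => f i s * X s j 0 + f j s * X s i 0) T.
  have TT : 0 <= T <= T by rewrite T0 lexx.
  rewrite (XE T TT i) (XE T TT j) -(prim_product T0 (fi i) (fi j)).
  by apply: eq_prim => s sT; rewrite (XE s sT i) (XE s sT j).
have y2i : seg_integrable 0 T (fun t => (K *m X t) 0 0 ^+ 2).
  exact/seg_integrable_continuous/continuous_sqr/continuous_mulmx_col.
have : 0 <= \sum_i \sum_j P i j * (X T i 0 * X T j 0).
  have := P0 (X T); rewrite mxE exchange_big /=.
  under eq_bigr => j _ do rewrite mxE mulr_suml.
  under [X in _ -> 0 <= X]eq_bigr => j _ do under eq_bigr => i _ do rewrite mulrA.
  by under eq_bigr => j _ do under eq_bigr => i _ do rewrite mxE [_ * P i j]mulrC.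
have sPi i j : seg_integrable 0 T (fun s => P i j * (f i s * X s j 0 + f j s * X s i 0)).
  exact: seg_integrableZl.
under eq_bigr => i _ do under eq_bigr => j _ do rewrite prodE -primZl//.
under eq_bigr => i _ do rewrite -prim_sum//.
rewrite -prim_sum; last by move=> i; exact: seg_integrable_sum.
move=> V0; rewrite -subr_ge0 -primZl// -prim_sub//; last exact: seg_integrableZl.
(* [PK] bounds half the derivative of the storage, since [P] is symmetric. *)
rewrite -(pmulr_rge0 _ (ltr0n R 2)) -primZl; last first.
  by apply: seg_integrableB => //; exact: seg_integrableZl.
apply: le_trans V0 _; apply: le_prim.
- by apply: seg_integrable_sum => i; exact: seg_integrable_sum.
- by apply/seg_integrableZl/seg_integrableB => //; exact: seg_integrableZl.
move=> s sT; apply: le_trans (ler_wpM2l (ler0n _ 2) (PK s sT)).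
rewrite le_eqVlt; apply/orP; left; apply/eqP.
have E1 : ((X s)^T *m P *m (A *m X s + v s *: B)) 0 0 =
    \sum_i \sum_j P i j * (f j s * X s i 0).
  rewrite mxE [RHS]exchange_big; apply: eq_bigr => j _; rewrite mxE mulr_suml.
  by apply: eq_bigr => i _; rewrite mxE -/(f j s); ring.
have E2 : \sum_i \sum_j P i j * (f i s * X s j 0) = \sum_i \sum_j P i j * (f j s * X s i 0).
  rewrite exchange_big; apply: eq_bigr => i _; apply: eq_bigr => j _.
  by rewrite -[in LHS]PT mxE.
rewrite E1; under eq_bigr => i _ do under eq_bigr => j _ do rewrite mulrDr.
under eq_bigr => i _ do rewrite big_split /=.
by rewrite big_split /= E2 mulr_natl mulr2n.
Qed.

(** * Closing the loop *)

Lemma within_continuous_comp_in (T U V : topologicalType) (D : set U)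
    (f : U -> V) (h : T -> U) :
  {within D, continuous f} -> continuous h -> (forall t, D (h t)) ->
  continuous (f \o h).
Proof.
move=> /subspace_continuousP cf ch hD t.
move=> Q /(cf (h t) (hD t)); rewrite /within /= => /(ch t).
by apply: (@filterS _ (nbhs t)) => s /= H; apply: H; exact: hD.
Qed.

Theorem theorem1 (R : realType) (n : nat) (c c0 : R) (A : 'M[R]_n)
    (B : 'cV[R]_n) (K : 'rV[R]_n) (hn : (1 <= n)%N) (hc : 0 < c) (hc0 : 0 < c0)
    (hA : hurwitz A) (hH1 : transfer_norm A B K < 1)
    (hHc : transfer_norm A B K < c * c0) :
  io_stable c c0 A B K.
Proof.
move=> r hr X u [cX odeX cu u0 uy weak].
(* A midpoint, strictly between the norm and [min 1 (c c0)]; the [max 0] makes it nonnegative. *)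
pose g := (Num.max 0 (transfer_norm A B K) + Num.min 1 (c * c0)) / 2.
have cc0 : 0 < c * c0 by rewrite mulr_gt0.
have [g0 [g1 [gc Tg]]] : 0 <= g /\ g < 1 /\ g < c * c0 /\ transfer_norm A B K < g.
  rewrite /g; have [h1|h1] := leP 0 (transfer_norm A B K);
  have [h2|h2] := leP 1 (c * c0); (split; [|split; [|split]]); lra.
have [N [P [NB NA PT P0 PK]]] := bounded_real hn hA Tg.
(* Extension by the initial value, which is 0: the delay equation is stated for all real times, with
   traces vanishing up to time 0. *)
pose Xe t := X (Num.max 0 t).
have cpos := @continuous_pos R.
have cXe j : continuous (fun t => Xe t j 0).
  apply: (within_continuous_comp_in (cX j) cpos) => t /=.
  by rewrite in_itv /= andbT le_max lexx.
pose w t := u 1 (Num.max 0 t); pose y t := (K *m Xe t) 0 0.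
have cw : continuous w.
  have ch : continuous (fun t : R => (1 : R, Num.max 0 t)).
    move=> t; apply: (@cvg_pair _ _ _ (nbhs t) (nbhs (1 : R)) (nbhs (Num.max 0 t))); [exact: cvg_cst|exact: cpos].
  have hD (t : R) : (`[0, 1] `*` `[0, +oo[)%classic (1 : R, Num.max 0 t).
    split; rewrite /= in_itv /=; first by rewrite ler01 lexx.
    by rewrite andbT le_max lexx.
  exact: within_continuous_comp_in cu ch hD.
have cy : continuous y by exact: continuous_mulmx_col.
have Xe0 t : t <= 0 -> Xe t = 0.
  move=> t0; apply/colP => i; rewrite /Xe max_l// odeX// set_itv1.
  by rewrite Rintegral_set1 addr0.
have w0 t : t <= 0 -> w t = 0 by move=> t0; rewrite /w max_l// u0// ler01 lexx.
have y0 t : t <= 0 -> y t = 0 by move=> t0; rewrite /y Xe0// mulmx0 mxE.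
have uw t : 0 <= t -> u 1 t = w t by move=> t0; rewrite /w max_r.
have XXe t : 0 <= t -> X t = Xe t by move=> t0; rewrite /Xe max_r.
have ty : forall t, 0 <= t -> u 0 t = y t by move=> t t0; rewrite uy// XXe.
have refl := weak_reflection hc weak cw cy w0 y0 uw ty.
have ci0 : 0 < c^-1 by rewrite invr_gt0.
have AB : `|c^-1 - c0| < c^-1 + c0 by rewrite ltr_norml; apply/andP; split; lra.
have gain := delay_gain (ltW ci0) cw cy AB w0 y0 refl.
have [E rE] := bounded_energy_prim hr.
pose v t := w t + r t.
have ode t : 0 <= t -> forall i, Xe t i 0 = prim 0 (fun s => (A *m Xe s + v s *: B) i 0) t.
  move=> t0 i; rewrite -XXe// odeX// mxE add0r; apply: eq_prim => s /andP[s0 _].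
  by rewrite XXe// uw.
have vi T : 0 <= T -> seg_integrable 0 T v.
  by move=> /rE[ri _ _]; exact/seg_integrableD/ri/seg_integrable_continuous.
have v2i T : 0 <= T -> seg_integrable 0 T (fun t => v t ^+ 2).
  move=> /rE[ri r2i _].
  have -> : (fun t => v t ^+ 2) = (fun t => w t ^+ 2 + r t * (2 * w t) + r t ^+ 2).
    by apply/funext => t; rewrite /v; ring.
  apply: seg_integrableD r2i; apply: seg_integrableD.
    exact/seg_integrable_continuous/continuous_sqr.
  apply: seg_integrableM ri _; apply: continuous_subspaceT => t.
  by apply: cvgM; [exact: cvg_cst|exact: cw].
have diss T : 0 <= T ->
    prim 0 (fun t => y t ^+ 2) T <= g ^+ 2 * prim 0 (fun t => v t ^+ 2) T.
  move=> T0.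
  have NX := state_annihilated NB NA cXe (vi T T0) (fun t tT => ode t (andP tT).1).
  apply: (state_dissipation PT P0 T0 cXe (vi T T0) (v2i T T0))
    => [t tT|t /andP[t0 _]]; last exact: ode.
  by apply: PK; exact: NX.
(* The gain of the string is [(2 / c) / k]: [1 / (c c0)] if [c^-1 >= c0] and 1 otherwise. These are
   the two cases of [gk], settled by [g < c c0] and [g < 1]. *)
pose k := c^-1 + c0 - `|c^-1 - c0|; have k0 : 0 < k by rewrite subr_gt0.
have gk : g * (2 / c) < k.
  rewrite /k; have [h|h] := leP 0 (c^-1 - c0).
    by rewrite ger0_norm// mulrA ltr_pdivrMr//; nra.
  rewrite ltr0_norm// (_ : _ - - _ = 2 / c); last by ring.
  by rewrite gtr_pMl// divr_gt0.
(* The square of the loop gain. *)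
pose q := (g * (2 / c) / k) ^+ 2.
have gc0 : 0 <= g * (2 / c) / k by rewrite divr_ge0 ?(ltW k0)// mulr_ge0// divr_ge0// ltW.
have q1 : q < 1 by rewrite expr_lt1// ltr_pdivrMr// mul1r.
have q0 : 0 <= q by exact: sqr_ge0.
(* Weight for splitting [(w + r)^2], small enough for [q (1 + e) < 1]: indeed
   [1 - q (1 + e) = (1 - q) (1 - q / 2)]. *)
pose e := (1 - q) / 2; have e0 : 0 < e by rewrite divr_gt0// subr_gt0.
have qe : 0 < 1 - q * (1 + e) by rewrite /e; nra.
have vE T : 0 <= T -> prim 0 (fun t => v t ^+ 2) T <=
    (1 + e) * prim 0 (fun t => w t ^+ 2) T + (1 + e^-1) * E.
  move=> T0; have [ri r2i rT] := rE T T0.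
  have w2i : seg_integrable 0 T (fun t => w t ^+ 2).
    exact/seg_integrable_continuous/continuous_sqr.
  apply: (@le_trans _ _ (prim 0 (fun t => (1 + e) * w t ^+ 2 + (1 + e^-1) * r t ^+ 2) T)).
    apply: le_prim => [||t _].
    - exact: v2i.
    - by apply: seg_integrableD; exact: seg_integrableZl.
    rewrite -subr_ge0 /v.
    rewrite (_ : _ - _ = (e * w t - r t) ^+ 2 / e); last by field; rewrite gt_eqF.
    by rewrite divr_ge0 ?sqr_ge0// ltW.
  rewrite primD; try exact: seg_integrableZl.
  rewrite !primZl// lerD2l ler_wpM2l// addr_ge0// invr_ge0 ltW//.
(* Solves [I <= q (1 + e) I + g^2 (1 + 1/e) E] for the finite energy [I] of [y] on [[0, T]]. *)
pose C := g ^+ 2 * (1 + e^-1) * E / (1 - q * (1 + e)).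
apply: (@prim_bounded_energy _ _ C) => [|T T0].
  apply: (@subspace_eq_continuous _ _ _ y); last exact: continuous_subspaceT.
  by move=> t; rewrite inE /= in_itv /= andbT => t0; rewrite /y -XXe.
rewrite (@eq_prim _ _ _ _ (fun t => y t ^+ 2)) => [|t /andP[t0 _]]; last by rewrite /y -XXe.
rewrite ler_pdivlMr//.
have H1 := diss T T0; have H2 := vE T T0; have H3 := gain T T0.
set Iy := prim 0 (fun t => y t ^+ 2) T in H1 H3 *.
set Iw := prim 0 (fun t => w t ^+ 2) T in H2 H3.
have H4 : g ^+ 2 * Iw <= q * Iy.
  have -> : g ^+ 2 * Iw = (g / k) ^+ 2 * (k ^+ 2 * Iw) by field; rewrite gt_eqF.
  have -> : q * Iy = (g / k) ^+ 2 * ((2 / c) ^+ 2 * Iy).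
    by rewrite /q; field; rewrite !gt_eqF.
  by rewrite ler_wpM2l ?sqr_ge0.
have H5 := ler_wpM2l (sqr_ge0 g) H2.
have H6 : 0 <= 1 + e by rewrite addr_ge0// ltW.
have H7 := ler_wpM2l H6 H4.
lra.
Qed.
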